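(* Let $\mathcal S\colon\mathtt C\to\mathtt{FVec}$ be a stem, let $X,Y$ be finite-dimensional real vector spaces, let $\mathcal G,\mathcal E$ be $\mathcal S$-systems on $X$, let $\mathcal D$ be an $\mathcal S$-system on $Y$, let $\Psi\in\mathrm{Lin}(X,Y)$ with dual map $\Psi'\in\mathrm{Lin}(Y',X')$, and let $D\subseteq X$ be a closed convex cone. Then: (i) $\mathcal G^\vee$ is an $\mathcal S$-system on $X'$. (ii) Under the canonical identification $X=X''$, $(\mathcal G^\vee)^\vee=\mathcal G$. (iii) $\mathcal G\subseteq\mathcal E\Leftrightarrow\mathcal E^\vee\subseteq\mathcal G^\vee$. (iv) $\underline{\mathcal G}_D^{\,\vee}=\overline{\mathcal G}_{D^\vee}$ and $\overline{\mathcal G}_D^{\,\vee}=\underline{\mathcal G}_{D^\vee}$. (v) $(\mathcal G+\mathcal E)^\vee=\mathcal G^\vee\cap\mathcal E^\vee$ and $(\mathcal G\cap\mathcal E)^\vee=\mathcal G^\vee+\mathcal E^\vee$. (vi) $\Psi(\mathcal G)^\vee=(\Psi')^{-1}(\mathcal G^\vee)$ and $\Psi^{-1}(\mathcal D)^\vee=\Psi'(\mathcal D^\vee)$. (vii) $\Psi\in\mathrm{CP}(\mathcal E,\mathcal D)$ if and only if $\Psi'\in\mathrm{CP}(\mathcal D^\vee,\mathcal E^\vee)$. (viii) $\mathcal G$ is finitely generated if and only if $\mathcal G^\vee$ is an $\mathcal S$-hedron; and $\mathcal G$ is an $\mathcal S$-hedron if and only if $\mathcal G^\vee$ is finitely generated.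 (ix) $\mathcal G$ is the inverse image of some finitely generated system under a linear map if and only if $\mathcal G^\vee$ is an $\mathcal S$-hedrop; and $\mathcal G$ is an $\mathcal S$-hedrop if and only if $\mathcal G^\vee$ is the inverse image of some finitely generated system under a linear map.
   Context: All vector spaces are finite-dimensional and real; $\mathtt{FVec}$ is the category of these with linear maps, $\mathrm{Lin}(V,W)$ is the space of linear maps, $V'=\mathrm{Lin}(V,\mathbb R)$. For a convex cone $C\subseteq V$, $C^\vee=\{\varphi\in V'\mid\varphi(x)\ge 0\ \forall x\in C\}$. For convex cones $C\subseteq V$, $D\subseteq W$: $C\mathbin{\underline{\otimes}}D=\{\sum_i c_i\otimes d_i\mid c_i\in C,d_i\in D\}\subseteq V\otimes W$ (finite sums), and $C\mathbin{\overline{\otimes}}D=(C^\vee\mathbin{\underline{\otimes}}D^\vee)^\vee$, using $V''=V$. A star autonomous category is a symmetric monoidal category $(\mathtt C,\otimes,\mathbf 1)$ with a full and faithful functor ${}^*\colon\mathtt C^{\mathrm{op}}\to\mathtt C$ and a natural bijection $\mathtt C(a\otimes b,c)\cong\mathtt C(a,(b\otimes c^* )^* )$. $\mathtt{FVec}$ is star autonomous with the usual tensor product and dual. A stem is a star autonomous functor $\mathcal S\colon\mathtt C\to\mathtt{FVec}$, where $\mathtt C$ is star autonomous: i.e. a strong monoidal functor with natural isomorphisms $\mathcal S(c^* )\cong\mathcal S(c)'$, such that $\mathcal S$ carries the bijection $\mathtt C(a\otimes b,c)\cong\mathtt C(a,(b\otimes c^* )^* )$ to the corresponding bijection in $\mathtt{FVec}$.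 These isomorphisms are written as equalities: $\mathcal S(\mathbf 1)=\mathbb R$, $\mathcal S(\mathbf 1^* )=\mathbb R'=\mathbb R$, $\mathcal S(c\otimes d)=\mathcal S(c)\otimes\mathcal S(d)$, $\mathcal S(c^* )=\mathcal S(c)'$. For $c\in\mathtt C$: $A(c)=\{v\in\mathcal S(c)\mid\mathcal S(\varphi)(v)\ge 0\ \forall\varphi\in\mathtt C(c,\mathbf 1^* )\}$ and $B(c)=\overline{\mathrm{cone}}\{\mathcal S(\Phi)(1)\mid\Phi\in\mathtt C(\mathbf 1,c)\}$ (closed conic hull). An $\mathcal S$-system $\mathcal G$ on $X$ is a family of closed convex cones $\mathcal G(c)\subseteq X\otimes\mathcal S(c)$, $c\in\mathtt C$, with $(\mathrm{id}_X\otimes\mathcal S(\Phi))(\mathcal G(c))\subseteq\mathcal G(d)$ for all $\Phi\in\mathtt C(c,d)$. For systems on the same $X$, $\mathcal G\subseteq\mathcal E$ means $\mathcal G(c)\subseteq\mathcal E(c)$ for all $c$; smallest/largest systems are with respect to this order. For $\mathcal S$-systems $\mathcal G$ on $X$ and $\mathcal E$ on $Y$, $\mathrm{CP}(\mathcal G,\mathcal E)$ is the set of $\Psi\in\mathrm{Lin}(X,Y)$ with $(\Psi\otimes\mathrm{id}_{\mathcal S(c)})(\mathcal G(c))\subseteq\mathcal E(c)$ for all $c$. The intrinsic system $\mathcal A_d$ on $\mathcal S(d)$ is $\mathcal A_d(c)=A(d\otimes c)\subseteq\mathcal S(d)\otimes\mathcal S(c)$. Dual system: for $\mathcal G$ on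 $X$, $\mathcal G^\vee(c):=\mathcal G(c^* )^\vee\subseteq(X\otimes\mathcal S(c^* ))'=X'\otimes\mathcal S(c)$; under $X'\otimes\mathcal S(c)=\mathrm{Lin}(X,\mathcal S(c))$ this cone equals $\mathrm{CP}(\mathcal G,\mathcal A_c)$. Smallest and largest systems over a closed convex cone $D$: $\underline{\mathcal G}_D(c)=D\mathbin{\underline{\otimes}}B(c)$, $\overline{\mathcal G}_D(c)=D\mathbin{\overline{\otimes}}A(c)$. Operations: $(\mathcal G+\mathcal E)(c)$ is the closed convex cone generated by $\mathcal G(c)\cup\mathcal E(c)$; $(\mathcal G\cap\mathcal E)(c)=\mathcal G(c)\cap\mathcal E(c)$. For $\Psi\in\mathrm{Lin}(X,Y)$: inverse image $(\Psi^{-1}(\mathcal D))(c)=(\Psi\otimes\mathrm{id}_{\mathcal S(c)})^{-1}(\mathcal D(c))$ and image $(\Psi(\mathcal G))(c)=\overline{(\Psi\otimes\mathrm{id}_{\mathcal S(c)})(\mathcal G(c))}$ (closure). A system on $X$ has a concrete realization if it is the inverse image of some $\mathcal A_d$ under a linear map $X\to\mathcal S(d)$. An $\mathcal S$-hedron is a finite intersection of systems with a concrete realization. An $\mathcal S$-hedrop is the image of an $\mathcal S$-hedron under a linear map. A system $\mathcal G$ is finitely generated if there are finitely many $a_i\in\mathcal G(c_i)$, $i=1,\dots,n$, such that $\mathcal G$ is the smallest $\mathcal S$-system containing $a_1,\dots,a_n$ (at the levels $c_1,\dots,c_n$). *)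

(* Defs.v *)
From HB Require Import structures.
From mathcomp Require Import all_boot all_order all_algebra.
From mathcomp Require Import all_classical all_reals all_analysis.

Set Implicit Arguments.
Unset Strict Implicit.
Unset Printing Implicit Defensive.

Import Order.TTheory GRing.Theory Num.Theory.
Import numFieldNormedType.Exports.

Local Open Scope classical_set_scope.
Local Open Scope ring_scope.

Definition dual (R : realType) (V : vectType R) := 'Hom(V, R^o).
HB.instance Definition _ (R : realType) (V : vectType R) :=
  Vector.on (dual V).

Definition dual_map (R : realType) (V W : vectType R) (f : 'Hom(V, W)) :
    'Hom(dual W, dual V) :=
  linfun (fun psi : dual W => (psi \o f)%VF : dual V).

Definition bidual (R : realType) (V : vectType R) : 'Hom(V, dual (dual V)) :=
  linfun (fun v => linfun (fun phi : dual V => phi v : R^o) : dual (dual V)).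

(* V (x) W is realised as Lin(V', W), with v (x) w the map phi |-> phi v *: w;
   [tlift_tens] and [tensor_ext] give its universal property. *)
Definition tensor (R : realType) (V W : vectType R) := 'Hom(dual V, W).
HB.instance Definition _ (R : realType) (V W : vectType R) :=
  Vector.on (tensor V W).

Definition tens (R : realType) (V W : vectType R) (v : V) (w : W) :
    tensor V W :=
  linfun (fun phi : dual V => (phi v : R) *: w).

(* The linear map induced on V (x) W by f; meaningful for bilinear f only. *)
Definition tlift (R : realType) (V W Z : vectType R) (f : V -> W -> Z) :
    'Hom(tensor V W, Z) :=
  linfun (fun t : tensor V W => \sum_(i < \dim {:V})
    f (vbasis {:V})`_i (t (linfun (coord (vbasis {:V}) i : V -> R^o)))).

Definition tmap (R : realType) (V V2 W W2 : vectType R)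
    (f : 'Hom(V, V2)) (g : 'Hom(W, W2)) : 'Hom(tensor V W, tensor V2 W2) :=
  tlift (fun v w => tens (f v) (g w)).

(* The canonical map V' (x) W' -> (V (x) W)'. *)
Definition tdual (R : realType) (V W : vectType R) :
    'Hom(tensor (dual V) (dual W), dual (tensor V W)) :=
  tlift (fun (phi : dual V) (psi : dual W) =>
    tlift (fun v w => (phi v * psi w : R^o)) : dual (tensor V W)).

Section LinearAlgebra.
Context {R : realType}.
Implicit Types V W Z : vectType R.

Lemma linfunP V W (f : V -> W) : linear f -> linfun f =1 f.
Proof.
move=> fl v.
pose F : {linear V -> W} := HB.pack f (GRing.isLinear.Build R V W *:%R f fl).
exact: (lfunE F).
Qed.

Lemma dual_mapE V W (f : 'Hom(V, W)) (psi : dual W) (v : V) :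
  dual_map f psi v = psi (f v).
Proof.
rewrite linfunP; first exact: comp_lfunE.
move=> a p q; apply/lfunP => x.
by rewrite !(comp_lfunE, add_lfunE, scale_lfunE).
Qed.

Lemma bidualE V (v : V) (phi : dual V) : bidual V v phi = phi v.
Proof.
have lin x : linear (fun phi : dual V => phi x : R^o).
  by move=> a p q; rewrite add_lfunE scale_lfunE.
rewrite linfunP; first by rewrite linfunP.
move=> a x y; apply/lfunP => p; rewrite add_lfunE scale_lfunE.
by rewrite !linfunP // linearP.
Qed.

Lemma tensE V W (v : V) (w : W) (phi : dual V) : tens v w phi = phi v *: w.
Proof.
rewrite linfunP // => a p q.
by rewrite add_lfunE scale_lfunE scalerDl scalerA.
Qed.

Lemma tens_linl V W (w : W) : linear (fun v : V => tens v w).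
Proof.
move=> a x y; apply/lfunP => p.
by rewrite add_lfunE scale_lfunE !tensE linearP scalerDl scalerA.
Qed.

Lemma tens_linr V W (v : V) : linear (fun w : W => tens v w).
Proof.
move=> a x y; apply/lfunP => p.
by rewrite add_lfunE scale_lfunE !tensE scalerDr !scalerA mulrC.
Qed.

Lemma tlift_tens V W Z (f : V -> W -> Z) :
  (forall w, linear (f^~ w)) -> (forall v, linear (f v)) ->
  forall v w, tlift f (tens v w) = f v w.
Proof.
move=> fl fr v w; rewrite linfunP; last first.
  move=> a s t; rewrite scaler_sumr -big_split; apply: eq_bigr => i _ /=.
  by rewrite add_lfunE scale_lfunE fr.
pose F : {linear V -> Z} :=
  HB.pack (f^~ w) (GRing.isLinear.Build R V Z *:%R (f^~ w) (fl w)).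
pose H u : {linear W -> Z} :=
  HB.pack (f u) (GRing.isLinear.Build R W Z *:%R (f u) (fr u)).
have -> : f v w = F v by [].
rewrite [in RHS](coord_vbasis (memvf v)) linear_sum; apply: eq_bigr => i _.
rewrite tensE linfunP; last by move=> a x y; rewrite linearP.
by rewrite linearZ -[f _ _]/(H _ _) linearZ.
Qed.

Lemma tensor_ext V W Z (f g : 'Hom(tensor V W, Z)) :
  (forall v w, f (tens v w) = g (tens v w)) -> f = g.
Proof.
move=> fg; apply/lfunP => t.
suff -> : t = \sum_(i < \dim {:V}) tens (vbasis {:V})`_i
    (t (linfun (coord (vbasis {:V}) i : V -> R^o))).
  by rewrite (linear_sum f) (linear_sum g); apply: eq_bigr => i _; apply: fg.
apply/lfunP => p; rewrite sum_lfunE.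
have {1}-> : p = \sum_(i < \dim {:V})
    p (vbasis {:V})`_i *: linfun (coord (vbasis {:V}) i : V -> R^o).
  apply/lfunP => v; rewrite sum_lfunE [in LHS](coord_vbasis (memvf v)).
  rewrite linear_sum; apply: eq_bigr => i _.
  rewrite linearZ scale_lfunE linfunP; last by move=> a x y; rewrite linearP.
  by rewrite [LHS]mulrC.
rewrite (linear_sum (t : 'Hom(dual V, W))); apply: eq_bigr => i _.
by rewrite linearZ tensE.
Qed.

Lemma tmap_tens V V2 W W2 (f : 'Hom(V, V2)) (g : 'Hom(W, W2)) v w :
  tmap f g (tens v w) = tens (f v) (g w).
Proof.
apply: tlift_tens => [{}w|{}v] a x y; rewrite linearP.
  exact: tens_linl.
exact: tens_linr.
Qed.

Lemma tdual_tens V W (phi : dual V) (psi : dual W) v w :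
  tdual V W (tens phi psi) (tens v w) = phi v * psi w.
Proof.
have pE (p : dual V) (q : dual W) x y :
    tlift (fun v w => (p v * q w : R^o)) (tens x y) = p x * q y.
  apply: (@tlift_tens _ _ R^o) => [z|z] a s t; rewrite linearP.
    by rewrite mulrDl -scalerAl.
  by rewrite mulrDr -scalerAr.
rewrite /tdual tlift_tens // => [q|p] a x y; apply: tensor_ext => s t;
  rewrite add_lfunE scale_lfunE !pE add_lfunE scale_lfunE.
  by rewrite mulrDl -scalerAl.
by rewrite mulrDr -scalerAr.
Qed.

Lemma bidual_bij V : bijective (bidual V).
Proof.
have k0 : lker (bidual V) == 0%VS.
  rewrite -subv0; apply/subvP => v; rewrite memv_ker memv0 => /eqP v0.
  apply/eqP; rewrite (coord_vbasis (memvf v)) big1 // => i _.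
  have := congr1 (fun g : dual (dual V) =>
    g (linfun (coord (vbasis {:V}) i : V -> R^o))) v0.
  rewrite bidualE linfunP; last by move=> a x y; rewrite linearP.
  by move=> ->; rewrite zero_lfunE scale0r.
exists ((bidual V)^-1)%VF => [v|]; first by rewrite lker0_lfunK.
suff lim : limg (bidual V) = fullv.
  by move=> p; rewrite limg_lfunVK // lim memvf.
apply/eqP; rewrite eqEdim subvf limg_dim_eq; last by rewrite (eqP k0) capv0.
have dimE (U : vectType R) : dim (dual U) = dim U by rewrite /dim /= muln1.
by rewrite !dimvf !dimE /=.
Qed.

End LinearAlgebra.

Notation "V \ox W" := (tensor V W) (at level 40, left associativity).
Notation "v \ot w" := (tens v w) (at level 40, left associativity).

Section Cones.
Context {R : realType}.
Implicit Types V W : vectType R.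

(* The topology of a finite-dimensional space V is that of R^n, transported
   along the coordinate isomorphism of a basis (the choice is immaterial). *)
Definition coords V : V -> 'rV[R]_(\dim {:V}) :=
  passmx.rVof (vbasis {:V}).

Definition vclosure V (A : set V) : set V :=
  @coords V @^-1` closure (@coords V @` A).

Definition vclosed V (A : set V) := closed (@coords V @` A).

Definition convex_cone V (A : set V) :=
  [/\ A 0, (forall x y, A x -> A y -> A (x + y)) &
      (forall (a : R) x, 0 <= a -> A x -> A (a *: x))].

Definition closed_convex_cone V (A : set V) := convex_cone A /\ vclosed A.

Definition cone_hull V (A : set V) : set V := smallest (@convex_cone V) A.

Definition dual_cone V (A : set V) : set (dual V) :=
  [set phi | forall x, A x -> 0 <= phi x].

Definition min_tensor V W (A : set V) (B : set W) : set (V \ox W) :=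
  [set z | exists n (a : 'I_n -> V) (b : 'I_n -> W),
     [/\ forall i, A (a i), forall i, B (b i) & z = \sum_i a i \ot b i]].

(* The dual of A^\vee (x)_min B^\vee lives in (V' (x) W')'; it is read in
   V (x) W through V (x) W = V'' (x) W'' = (V' (x) W')'. *)
Definition max_tensor V W (A : set V) (B : set W) : set (V \ox W) :=
  [set z | dual_cone (min_tensor (dual_cone A) (dual_cone B))
             (tdual (dual V) (dual W) (tmap (bidual V) (bidual W) z))].

End Cones.

Record smcat := SMCat {
  cob :> Type;
  chom : cob -> cob -> Type;
  idc : forall a, chom a a;
  compc : forall a b c, chom b c -> chom a b -> chom a c;
  compc_idl : forall a b (f : chom a b), compc (idc b) f = f;
  compc_idr : forall a b (f : chom a b), compc f (idc a) = f;
  compcA : forall a b c d (h : chom c d) (g : chom b c) (f : chom a b),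
    compc h (compc g f) = compc (compc h g) f;
  otimes : cob -> cob -> cob;
  otimesh : forall a b c d,
    chom a b -> chom c d -> chom (otimes a c) (otimes b d);
  otimesh_id : forall a b, otimesh (idc a) (idc b) = idc (otimes a b);
  otimesh_comp : forall a b c a' b' c' (g : chom b c) (f : chom a b)
      (g' : chom b' c') (f' : chom a' b'),
    otimesh (compc g f) (compc g' f') = compc (otimesh g g') (otimesh f f');
  cunit : cob;
  associator : forall a b c,
    chom (otimes (otimes a b) c) (otimes a (otimes b c));
  associatorV : forall a b c,
    chom (otimes a (otimes b c)) (otimes (otimes a b) c);
  associatorK : forall a b c,
    compc (associatorV a b c) (associator a b c) = idc _;
  associatorVK : forall a b c,
    compc (associator a b c) (associatorV a b c) = idc _;
  associator_nat : forall a b c a' b' c'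
      (f : chom a a') (g : chom b b') (h : chom c c'),
    compc (associator a' b' c') (otimesh (otimesh f g) h) =
    compc (otimesh f (otimesh g h)) (associator a b c);
  lunitor : forall a, chom (otimes cunit a) a;
  lunitorV : forall a, chom a (otimes cunit a);
  lunitorK : forall a, compc (lunitorV a) (lunitor a) = idc _;
  lunitorVK : forall a, compc (lunitor a) (lunitorV a) = idc _;
  lunitor_nat : forall a b (f : chom a b),
    compc (lunitor b) (otimesh (idc cunit) f) = compc f (lunitor a);
  runitor : forall a, chom (otimes a cunit) a;
  runitorV : forall a, chom a (otimes a cunit);
  runitorK : forall a, compc (runitorV a) (runitor a) = idc _;
  runitorVK : forall a, compc (runitor a) (runitorV a) = idc _;
  runitor_nat : forall a b (f : chom a b),
    compc (runitor b) (otimesh f (idc cunit)) = compc f (runitor a);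
  braid : forall a b, chom (otimes a b) (otimes b a);
  braidK : forall a b, compc (braid b a) (braid a b) = idc _;
  braid_nat : forall a b a' b' (f : chom a a') (g : chom b b'),
    compc (braid a' b') (otimesh f g) = compc (otimesh g f) (braid a b);
  triangle : forall a b,
    compc (otimesh (idc a) (lunitor b)) (associator a cunit b) =
    otimesh (runitor a) (idc b);
  pentagon : forall a b c d,
    compc (associator a b (otimes c d)) (associator (otimes a b) c d) =
    compc (otimesh (idc a) (associator b c d))
      (compc (associator a (otimes b c) d)
        (otimesh (associator a b c) (idc d)));
  hexagon : forall a b c,
    compc (associator b c a) (compc (braid a (otimes b c)) (associator a b c)) =
    compc (otimesh (idc b) (braid a c))
      (compc (associator b a c) (otimesh (braid a b) (idc c)))
}.

Arguments chom {s} a b.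
Arguments idc {s} a.
Arguments compc {s a b c} g f.
Arguments otimes {s} a b.
Arguments otimesh {s a b c d} f g.
Arguments cunit {s}.
Arguments associator {s} a b c.
Arguments associatorV {s} a b c.
Arguments lunitor {s} a.
Arguments lunitorV {s} a.
Arguments runitor {s} a.
Arguments runitorV {s} a.
Arguments braid {s} a b.

Declare Scope smcat_scope.
Delimit Scope smcat_scope with smcat.
Bind Scope smcat_scope with cob.
Bind Scope smcat_scope with chom.
Notation "g \c f" := (compc g f)
  (at level 50, left associativity) : smcat_scope.
Notation "a \t* b" := (otimes a b)
  (at level 40, left associativity) : smcat_scope.
Notation "f \h* g" := (otimesh f g)
  (at level 40, left associativity) : smcat_scope.

Local Open Scope smcat_scope.

Record starcat := StarCat {
  starcat_sm :> smcat;
  star : starcat_sm -> starcat_sm;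
  starh : forall a b : starcat_sm, chom a b -> chom (star b) (star a);
  starh_id : forall a : starcat_sm, starh (idc a) = idc (star a);
  starh_comp : forall (a b c : starcat_sm) (g : chom b c) (f : chom a b),
    starh (g \c f) = starh f \c starh g;
  star_ff : forall a b : starcat_sm, bijective (@starh a b);
  scurry : forall a b c : starcat_sm,
    chom (a \t* b) c -> chom a (star (b \t* star c));
  scurry_bij : forall a b c : starcat_sm, bijective (@scurry a b c);
  scurry_natl : forall (a a' b c : starcat_sm) (h : chom (a \t* b) c)
      (f : chom a' a),
    scurry (h \c (f \h* idc b)) = scurry h \c f;
  scurry_natm : forall (a b b' c : starcat_sm) (h : chom (a \t* b) c)
      (g : chom b' b),
    scurry (h \c (idc a \h* g)) = starh (g \h* idc (star c)) \c scurry h;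
  scurry_natr : forall (a b c c' : starcat_sm) (h : chom (a \t* b) c)
      (k : chom c c'),
    scurry (k \c h) = starh (idc b \h* starh k) \c scurry h
}.

Arguments star {s} a.
Arguments starh {s a b} f.
Arguments scurry {s a b c} h.

(* A star autonomous functor S : C -> FVec, with structure isomorphisms
   smu : S a (x) S b -> S(a (x) b), seps : R -> S 1 and
   sdelta : S(star a) -> (S a)'.
   Coherence is stated on pure tensors, which determine linear maps on tensor
   products.  The bijection Lin(U (x) V, W) = Lin(U, (V (x) W')') of FVec sends
   h to u |-> (v (x) zeta |-> zeta (h (u (x) v))), which is what
   [stem_scurry] says of S h and S (scurry h) modulo smu and sdelta. *)
Record stem (R : realType) (C : starcat) := Stem {
  stem_ob :> C -> vectType R;
  stem_map : forall a b : C, chom a b -> 'Hom(stem_ob a, stem_ob b);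
  stem_map_id : forall a : C, stem_map (idc a) = \1%VF;
  stem_map_comp : forall (a b c : C) (g : chom b c) (f : chom a b),
    stem_map (g \c f) = (stem_map g \o stem_map f)%VF;
  smu : forall a b : C, 'Hom(stem_ob a \ox stem_ob b, stem_ob (a \t* b));
  smu_bij : forall a b : C, bijective (smu a b);
  smu_nat : forall (a b a' b' : C) (f : chom a a') (g : chom b b') u v,
    stem_map (f \h* g) (smu a b (u \ot v)) =
    smu a' b' (stem_map f u \ot stem_map g v);
  seps : 'Hom(R^o, stem_ob cunit);
  seps_bij : bijective seps;
  smu_assoc : forall (a b c : C) u v w,
    stem_map (associator a b c) (smu (a \t* b) c (smu a b (u \ot v) \ot w)) =
    smu a (b \t* c) (u \ot smu b c (v \ot w));
  smu_lunit : forall (a : C) u,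
    stem_map (lunitor a) (smu cunit a (seps 1 \ot u)) = u;
  smu_runit : forall (a : C) u,
    stem_map (runitor a) (smu a cunit (u \ot seps 1)) = u;
  sdelta : forall a : C, 'Hom(stem_ob (star a), dual (stem_ob a));
  sdelta_bij : forall a : C, bijective (sdelta a);
  sdelta_nat : forall (a b : C) (f : chom a b) x u,
    sdelta a (stem_map (starh f) x) u = sdelta b x (stem_map f u);
  stem_scurry : forall (a b c : C) (h : chom (a \t* b) c) u v
      (z : stem_ob (star c)),
    sdelta (b \t* star c) (stem_map (scurry h) u) (smu b (star c) (v \ot z)) =
    sdelta c z (stem_map h (smu a b (u \ot v)))
}.

Arguments stem_map {R C} s {a b} f.
Arguments smu {R C} s a b.
Arguments seps {R C} s.
Arguments sdelta {R C} s a.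

Section Systems.
Context {R : realType} {C : starcat} (S : stem R C).
Implicit Types (X Y : vectType R) (c d : C).

Definition sfamily X := forall c : C, set (X \ox S c).

Definition is_system X (G : sfamily X) :=
  (forall c, closed_convex_cone (G c)) /\
  (forall c d (Phi : chom c d) z,
     G c z -> G d (tmap \1%VF (stem_map S Phi) z)).

Definition sub_family X (G E : sfamily X) := forall c, G c `<=` E c.

Definition CP X Y (G : sfamily X) (E : sfamily Y) : set 'Hom(X, Y) :=
  [set Psi | forall c z, G c z -> E c (tmap Psi \1%VF z)].

(* S phi v lies in S(star 1) = (S 1)' = R', read in R by evaluation at 1. *)
Definition coneA c : set (S c) :=
  [set v | forall phi : chom c (star cunit),
     0 <= sdelta S cunit (stem_map S phi v) (seps S 1)].
Arguments coneA : clear implicits.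

Definition coneB c : set (S c) :=
  vclosure (cone_hull
    [set stem_map S Phi (seps S 1) | Phi in @setT (chom cunit c)]).
Arguments coneB : clear implicits.

Definition intrinsic d : sfamily (S d) :=
  fun c => smu S d c @^-1` coneA (d \t* c).

(* S c -> S(star c)', the transpose of sdelta precomposed with S c = (S c)''. *)
Definition sdelta_tr c : 'Hom(S c, dual (S (star c))) :=
  (dual_map (sdelta S c) \o bidual (S c))%VF.

(* The dual cone of G(star c), read in X' (x) S c through
   X' (x) S c = X' (x) S(star c)' = (X (x) S(star c))'. *)
Definition dual_family X (G : sfamily X) : sfamily (dual X) :=
  fun c => [set z | dual_cone (G (star c))
              (tdual X (S (star c)) (tmap \1%VF (sdelta_tr c) z))].

Definition min_family X (K : set X) : sfamily X :=
  fun c => min_tensor K (coneB c).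

Definition max_family X (K : set X) : sfamily X :=
  fun c => max_tensor K (coneA c).

Definition add_family X (G E : sfamily X) : sfamily X :=
  fun c => smallest (@closed_convex_cone R (X \ox S c)) (G c `|` E c).

Definition cap_family X (G E : sfamily X) : sfamily X :=
  fun c => G c `&` E c.

Definition preim_family X Y (Psi : 'Hom(X, Y)) (D : sfamily Y) : sfamily X :=
  fun c => tmap Psi \1%VF @^-1` D c.

Definition im_family X Y (Psi : 'Hom(X, Y)) (G : sfamily X) : sfamily Y :=
  fun c => vclosure (tmap Psi \1%VF @` G c).

Definition concrete X (G : sfamily X) :=
  exists d (Psi : 'Hom(X, S d)), G = preim_family Psi (@intrinsic d).

Definition hedron X (G : sfamily X) :=
  exists n (H : 'I_n -> sfamily X),
    (forall i, concrete (H i)) /\ G = (fun c => \bigcap_i H i c).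

Definition hedrop X (G : sfamily X) :=
  exists (Z : vectType R) (H : sfamily Z) (Psi : 'Hom(Z, X)),
    hedron H /\ G = im_family Psi H.

Definition finitely_generated X (G : sfamily X) :=
  is_system G /\
  exists n (c : 'I_n -> C) (a : forall i, X \ox S (c i)),
    (forall i, G (c i) (a i)) /\
    (forall E : sfamily X, is_system E -> (forall i, E (c i) (a i)) ->
       sub_family G E).

Definition preim_finitely_generated X (G : sfamily X) :=
  exists (Z : vectType R) (H : sfamily Z) (Psi : 'Hom(X, Z)),
    finitely_generated H /\ G = preim_family Psi H.

End Systems.

Arguments coneA {R C} S c.
Arguments coneB {R C} S c.
Arguments intrinsic {R C} S d.
Arguments sdelta_tr {R C} S c.
Arguments min_family {R C} S {X} K.
Arguments max_family {R C} S {X} K.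

(* Main.v *)
Require Import Defs.
From mathcomp Require Import all_boot all_order all_algebra.
From mathcomp Require Import all_classical all_reals all_analysis.
From HB Require Import structures.
From mathcomp Require Import ring lra.

(** Everything rests on one fact of convex geometry and one of category
    theory.

    Convex geometry: a closed convex cone of a finite-dimensional space is
    the set of points on which the forms of its dual cone are nonnegative
    ([closed_convex_coneP]).  The proof separates a point from a closed cone
    by the nearest point.  Through any perfect pairing, a closed convex cone
    is therefore recovered from its polar, once on each side
    ([pairing_polar_l], [pairing_polar_r]).

    Category theory: the bijection C(a (x) b, c) = C(a, star (b (x) star c)),
    read at b = 1, gives a natural isomorphism c = star (star c), and a stem
    sends it to the canonical V = V'' ([sdelta_double_dual_unit]).  The dual
    family is the polar for a perfect pairing [spair] of X' (x) S c with
    X (x) S (star c), and [spair] turns S Phi into S (starh Phi) and Psi' into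
    Psi.  So a system is determined by its dual ([systemP]); biduality, the
    order reversal, the formulas for sums, intersections, images and inverse
    images, and the statement on completely positive maps are polarity
    computations.

    For the smallest and largest systems, A and B are dual to each other
    ([coneAP], [coneA_starP]).  The smallest system uses the algebraic tensor
    product of cones, without closure, so one must know that it is closed
    ([closed_convex_cone_min_tensor]).  When neither cone contains a line,
    each has a form that is strictly positive on its nonzero elements;
    normalising by these forms and using Caratheodory's theorem, a bounded
    part of the tensor product is a continuous image of a compact set.  In general z in the closure is split
    into its part off the lines of both cones and two remainders, each of
    which has a factor in a space of lines and so lies in the product.

    Finally, an element a of X (x) S c is a linear map X' -> S c, and the
    inverse image of the intrinsic system of c under a is the polar of the
    orbit of a under the morphisms c -> star d ([concreteP]), because such
    morphisms are the same as morphisms c (x) d -> star 1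
    ([transpose_surj]).  Hence the hedra on X' are exactly the duals of the
    finitely generated systems on X, and the statements on hedrops follow
    from the formulas for images and inverse images. *)

Set Implicit Arguments.
Unset Strict Implicit.
Unset Printing Implicit Defensive.

Import Order.TTheory GRing.Theory Num.Theory.
Import numFieldNormedType.Exports.

Local Open Scope classical_set_scope.
Local Open Scope ring_scope.
Local Open Scope smcat_scope.

(** * Coordinates and the bipolar theorem *)

Section Coordinates.
Context {R : realType}.
Implicit Types V W : vectType R.

Definition uncoords V (p : 'rV[R]_(\dim {:V})) : V :=
  passmx.vecof (vbasis {:V}) p.

Lemma coordsK V : cancel (@coords R V) (@uncoords V).
Proof. by move=> v; apply: passmx.rVofK; exact: vbasisP. Qed.

Lemma uncoordsK V : cancel (@uncoords V) (@coords R V).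
Proof. by move=> p; apply: passmx.vecofK; exact: vbasisP. Qed.

Lemma uncoords_linear V : linear (@uncoords V).
Proof. exact: passmx.vecof_linear. Qed.

Lemma coords_linear V : linear (@coords R V).
Proof. exact: passmx.rVof_linear. Qed.

HB.instance Definition _ V := GRing.isLinear.Build R _ V *:%R (@uncoords V)
  (@uncoords_linear V).
HB.instance Definition _ V := GRing.isLinear.Build R V _ *:%R (@coords R V)
  (@coords_linear V).

Lemma coords_img V (A : set V) p : (@coords R V @` A) p <-> A (uncoords p).
Proof.
split=> [[x Ax <-]|Ap]; first by rewrite coordsK.
by exists (uncoords p) => //; rewrite uncoordsK.
Qed.

Lemma linear_rV_continuous n (U : normedModType R) (f : 'rV[R]_n -> U) :
  linear f -> continuous f.
Proof.
move=> fl.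
pose F : {linear 'rV[R]_n -> U} :=
  HB.pack f (GRing.isLinear.Build R 'rV[R]_n U *:%R f fl).
have -> : f = fun p => \sum_(i < n) p 0 i *: f 'e_i.
  apply/funext => p; rewrite {1}(row_sum_delta p) -[f _]/(F _) linear_sum.
  by apply: eq_bigr => i _; rewrite linearZ.
apply: continuous_big => [|i _ p]; first exact: add_continuous.
exact: (cvgZr_tmp (@coord_continuous R 1 n 0 i p)).
Qed.

Lemma closure_preimage_subset (T U : topologicalType) (f : T -> U)
    (A : set T) (B : set U) :
  continuous f -> closed B -> (forall x, A x -> B (f x)) ->
  forall x, closure A x -> B (f x).
Proof.
move=> fc Bc AB x Ax.
have /continuous_closedP/(_ B Bc) clB := fc.
suff: closure (f @^-1` B) x by move/clB.
exact: closure_subset Ax.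
Qed.

Lemma closure_invariant (T : topologicalType) (f : T -> T) (A : set T) :
  continuous f -> (forall x, A x -> closure A (f x)) ->
  forall x, closure A x -> closure A (f x).
Proof.
by move=> fc fA x; apply: closure_preimage_subset => //; exact: closed_closure.
Qed.

Lemma vclosure_sub V (A : set V) : A `<=` vclosure A.
Proof. by move=> x Ax; apply: subset_closure; exists x. Qed.

Lemma vclosedP V (A : set V) : vclosed A <-> vclosure A `<=` A.
Proof.
split=> [Ac x Ax|Ac p /= Ap].
  by rewrite -(coordsK x) -coords_img; apply: Ac.
by apply/coords_img; apply: Ac; rewrite /vclosure /= uncoordsK.
Qed.

Lemma dual_cone_vclosure V (A : set V) : dual_cone (vclosure A) = dual_cone A.
Proof.
apply/seteqP; split=> phi hphi x Ax; first by apply/hphi/vclosure_sub.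
rewrite -(coordsK x).
apply: (@closure_preimage_subset _ R (fun p => phi (uncoords p)) _
  [set r : R | 0 <= r] _ _ _ _ Ax).
- apply: (@linear_rV_continuous _ R^o) => a p q.
  by rewrite uncoords_linear linearP.
- exact: closed_ge.
- by move=> p /coords_img /hphi.
Qed.

Definition dot n (p q : 'rV[R]_n) : R := \sum_i p 0 i * q 0 i.

Lemma dot_linear n (p : 'rV[R]_n) : linear (dot p : _ -> R^o).
Proof.
move=> a x y; rewrite /dot scaler_sumr -big_split; apply: eq_bigr => i _ /=.
by rewrite !mxE mulrDr mulrCA.
Qed.

Lemma dotC n (p q : 'rV[R]_n) : dot p q = dot q p.
Proof. by apply: eq_bigr => i _; rewrite mulrC. Qed.

Lemma dotDr n (p x y : 'rV[R]_n) : dot p (x + y) = dot p x + dot p y.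
Proof. by rewrite -[x]scale1r dot_linear !scale1r. Qed.

Lemma dotZr n (p x : 'rV[R]_n) a : dot p (a *: x) = a * dot p x.
Proof.
have := dot_linear p a x 0; rewrite addr0 => ->.
by rewrite [X in _ + X]big1 ?addr0 // => i _; rewrite mxE mulr0.
Qed.

Lemma dot_sqrD n (d u : 'rV[R]_n) :
  dot (d + u) (d + u) = dot d d + 2 * dot d u + dot u u.
Proof. by rewrite dotDr (dotC _ d) (dotC _ u) !dotDr (dotC u d); ring. Qed.

Lemma dot_sqr_ge n (p : 'rV[R]_n) : `|p| ^+ 2 <= dot p p.
Proof.
have [->|p0] := eqVneq p 0.
  by rewrite normr0 expr0n /= sumr_ge0 // => i _; rewrite mxE mulr0.
have [[i j] pij] : exists i, mx_norm p = `|p i.1 i.2|.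
  by apply: mx_norm_neq0; move: p0; rewrite -normr_eq0.
rewrite {1}/Num.Def.normr /= pij /= real_normK ?num_real //.
rewrite (ord1 i) /dot (bigD1 j) //= -expr2 lerDl.
by apply: sumr_ge0 => k _; rewrite -expr2 sqr_ge0.
Qed.

Lemma dot_ge0 n (p : 'rV[R]_n) : 0 <= dot p p.
Proof. by apply: le_trans (dot_sqr_ge p); rewrite sqr_ge0. Qed.

(** Only a bounded piece of F competes with a given point y0 of F, and that
    piece is compact. *)
Lemma nearest_point n (F : set 'rV[R]_n) (x : 'rV[R]_n) :
  closed F -> F !=set0 ->
  exists2 y, F y & forall z, F z -> dot (y - x) (y - x) <= dot (z - x) (z - x).
Proof.
move=> Fcl [y0 Fy0].
pose f (y : 'rV[R]_n) := dot (y - x) (y - x).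
have fc : continuous f.
  apply: (@continuous_big R) => [|i _ p]; first exact: (@add_continuous R).
  have cc : {for p, continuous (fun q : 'rV[R]_n => (q - x) 0 i)}.
    have -> : (fun q : 'rV[R]_n => (q - x) 0 i) = (fun q => q 0 i - x 0 i).
      by apply/funext => q; rewrite !mxE.
    exact: (cvgB (@coord_continuous R 1 n 0 i p) (cvg_cst _)).
  exact: (cvgM cc cc).
pose A := F `&` f @^-1` [set r | r <= f y0].
have Acl : closed A.
  apply: closedI => //.
  by apply: (continuous_closedP _).1 => //; apply: closed_le.
have Abd : bounded_set A.
  exists (f y0 + 1 + `|x|); split; first exact: num_real.
  move=> M hM y [_ /= fy].
  apply: le_trans (ltW hM); rewrite -{1}(subrK x y).
  apply: (le_trans (ler_normD _ _)); rewrite lerD2r.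
  have h1 := le_trans (dot_sqr_ge (y - x)) fy.
  have h2 := sqr_ge0 (`|y - x| - 1).
  have h3 := normr_ge0 (y - x).
  by nra.
have Ac := bounded_closed_compact Abd Acl.
have A0 : A !=set0 by exists y0; split => //=.
have [y yA ymin] := compact_EVT_min A0 Ac (continuous_subspaceT fc).
move: yA; rewrite inE => -[Fy fy]; exists y => // z Fz.
have [zle|zgt] := leP (f z) (f y0); first by apply: ymin; rewrite inE; split.
by apply: le_trans fy (ltW zgt).
Qed.

(** If x is outside the closure F, let y be the point of F nearest to it and
    d = y - x.  Moving y inside F, along A and along its own ray, shows
    that d is nonnegative on A and orthogonal to y; so d takes the value
    - |d|^2 < 0 at x. *)
Lemma bipolar V (A : set V) x : convex_cone A ->
  (forall phi, dual_cone A phi -> 0 <= phi x) -> vclosure A x.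
Proof.
move=> [A0 AD AZ] hx; apply: contrapT => nx.
pose F := closure (@coords R V @` A); pose p := coords x.
have Fcl : closed F by exact: closed_closure.
have [y Fy ymin] : exists2 y, F y &
    forall z, F z -> dot (y - p) (y - p) <= dot (z - p) (z - p).
  apply: nearest_point => //; exists (coords (0 : V)).
  by apply: subset_closure; exists 0.
have [d dE] : exists d, d = y - p by exists (y - p).
rewrite -dE in ymin.
have FD a : A a -> F (y + coords a).
  move=> Aa.
  have h1 : continuous (fun q : 'rV[R]_(\dim {:V}) => q + coords a).
    by move=> q; exact: (cvgD cvg_id (cvg_cst _)).
  apply: (closure_invariant h1 (A := @coords R V @` A) _ Fy) => _ [b Ab <-].
  rewrite -linearD.
  by apply: subset_closure; exists (b + a) => //; apply: AD.
have FZ t : 0 <= t -> F (t *: y).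
  move=> t0.
  have h1 : continuous (fun q : 'rV[R]_(\dim {:V}) => t *: q).
    exact: scaler_continuous.
  apply: (closure_invariant h1 (A := @coords R V @` A) _ Fy) => _ [b Ab <-].
  rewrite -linearZ; apply: subset_closure; exists (t *: b) => //.
  exact: AZ.
(* First-order condition at a minimum: 2 t b + t^2 c is the change of the
   squared distance when y moves by t. *)
have quad (b c : R) : 0 <= c ->
    (forall t : R, 0 < t -> t <= 1 -> 0 <= 2 * (t * b) + t ^+ 2 * c) -> 0 <= b.
  move=> c0 H; rewrite leNgt; apply/negP => b0.
  have s0 : 0 < - b / (c - b) by rewrite divr_gt0 // ; lra.
  have s1 : - b / (c - b) <= 1 by rewrite ler_pdivrMr; lra.
  have e : (- b / (c - b)) * (c - b) = - b by rewrite divfK //; apply/eqP; lra.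
  by have := H _ s0 s1; move: s0 s1 e; set s := _ / _; nra.
have dA a : A a -> 0 <= dot d (coords a).
  move=> Aa; apply: (quad _ (dot (coords a) (coords a))); first exact: dot_ge0.
  move=> t t0 _; have := ymin _ (FD (t *: a) (AZ _ _ (ltW t0) Aa)).
  rewrite addrAC -dE dot_sqrD !linearZ /=.
  rewrite !dotZr [dot (_ *: _) _]dotC dotZr; nra.
have dy : dot d y = 0.
  apply/eqP; rewrite eq_le; apply/andP; split.
    rewrite -oppr_ge0; apply: (quad _ (dot y y)); first exact: dot_ge0.
    move=> t t0 t1; have /FZ/ymin : 0 <= 1 - t by lra.
    rewrite scalerBl scale1r addrAC -dE -scaleNr dot_sqrD.
    by rewrite !dotZr [dot (_ *: _) _]dotC dotZr; nra.
  apply: (quad _ (dot y y)); first exact: dot_ge0.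
  move=> t t0 _; have /FZ/ymin : 0 <= 1 + t by lra.
  rewrite scalerDl scale1r addrAC -dE dot_sqrD.
  by rewrite !dotZr [dot (_ *: _) _]dotC dotZr; nra.
have philin : linear (fun v : V => dot d (coords v) : R^o).
  by move=> a u v; rewrite coords_linear dot_linear.
pose phi : dual V := linfun (fun v : V => dot d (coords v) : R^o).
have phiE v : phi v = dot d (coords v) by rewrite /phi linfunP.
have : 0 <= phi x by apply: hx => a Aa; rewrite phiE dA.
have -> : phi x = - dot d d.
  by rewrite phiE -/p -[p](subKr y) -dE -scaleN1r dotDr dotZr dy; ring.
have d0 := dot_sqr_ge d; have n0 := normr_ge0 d => hd.
have : `|d| = 0 by nra.
move/eqP; rewrite normr_eq0 dE subr_eq0 => /eqP yp.
by apply: nx; rewrite /vclosure /= -/p -yp.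
Qed.

End Coordinates.

(** * Closed convex cones and their duals *)

Section ConvexCones.
Context {R : realType}.
Implicit Types V W : vectType R.

(** By the bipolar theorem, membership in a closed convex cone is a family of
    linear inequalities; conversely, any set cut out by linear inequalities is
    shown to be a closed convex cone through this equivalence. *)
Lemma closed_convex_coneP V (A : set V) : closed_convex_cone A <->
  (forall x, (forall phi, dual_cone A phi -> 0 <= phi x) -> A x).
Proof.
split=> [[Acone /vclosedP Acl] x hx|hA]; first exact/Acl/bipolar.
split; last first.
  apply/vclosedP => x Ax; apply: hA => phi.
  by rewrite -dual_cone_vclosure; apply.
split=> [|x y Ax Ay|a x a0 Ax]; apply: hA => phi hphi.
- by rewrite linear0.
- by rewrite linearD addr_ge0 ?hphi.
- by rewrite linearZ mulr_ge0 ?hphi.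
Qed.

Lemma closed_convex_cone_vclosure V (A : set V) :
  convex_cone A -> closed_convex_cone (vclosure A).
Proof.
move=> Acone; apply/closed_convex_coneP => x; rewrite dual_cone_vclosure.
exact: bipolar.
Qed.

Lemma closed_convex_cone_polar V I (P : I -> Prop) (f : I -> dual V) :
  closed_convex_cone [set x | forall i, P i -> 0 <= f i x].
Proof. by apply/closed_convex_coneP => x hx i Pi; apply: hx => y /(_ i Pi). Qed.

Lemma closed_convex_cone_preimage V W (f : 'Hom(V, W)) (A : set W) :
  closed_convex_cone A -> closed_convex_cone (f @^-1` A).
Proof.
move=> /closed_convex_coneP hA; apply/closed_convex_coneP => x hx.
apply: hA => phi hphi.
have := hx (phi \o f)%VF; rewrite comp_lfunE; apply=> y Ay.
by rewrite comp_lfunE; apply: hphi.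
Qed.

Lemma closed_convex_cone_bigcap V I (A : I -> set V) :
  (forall i, closed_convex_cone (A i)) -> closed_convex_cone (\bigcap_i A i).
Proof.
move=> hA; apply/closed_convex_coneP => x hx i _.
have /closed_convex_coneP := hA i; apply=> phi hphi; apply: hx => y Ay.
by apply: hphi; apply: Ay.
Qed.

Lemma dual_cone_cone_hull V (A : set V) : dual_cone (cone_hull A) = dual_cone A.
Proof.
apply/seteqP; split=> phi hphi x Ax; first by apply: hphi => B [_]; apply.
apply: (Ax [set y | 0 <= phi y]); split=> //; split=> [|y z|a y] /=.
- by rewrite linear0.
- by rewrite linearD; exact: addr_ge0.
- by rewrite linearZ; exact: mulr_ge0.
Qed.

Lemma convex_cone_hull V (A : set V) : convex_cone (cone_hull A).
Proof.
split=> [B [[]]//|x y Ax Ay B BA|a x a0 Ax B BA].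
  by case: (BA) => -[_ BD _] _; apply: BD; [apply: Ax|apply: Ay].
by case: (BA) => -[_ _ BZ] _; apply: BZ => //; apply: Ax.
Qed.

Lemma convex_cone_image V W (f : 'Hom(V, W)) (A : set V) :
  convex_cone A -> convex_cone (f @` A).
Proof.
move=> [A0 AD AZ].
split=> [|_ _ [x Ax <-] [y Ay <-]|a _ a0 [x Ax <-]].
- by exists 0; rewrite ?linear0.
- by exists (x + y); rewrite ?linearD //; apply: AD.
- by exists (a *: x); rewrite ?linearZ //; apply: AZ.
Qed.

(** A subspace of maximal dimension inside A absorbs every line of A. *)
Lemma lineality_space V (A : set V) : convex_cone A ->
  exists U : {vspace V}, forall x, x \in U <-> A x /\ A (- x).
Proof.
move=> [A0 AD AZ].
pose P n :=
  `[< exists U : {vspace V}, (forall x, x \in U -> A x) /\ \dim U = n >].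
have exP : exists n, P n.
  exists 0; apply/asboolP; exists 0%VS; split; last exact: dimv0.
  by move=> x; rewrite memv0 => /eqP ->.
have ubP n : P n -> (n <= \dim {:V})%N.
  by move=> /asboolP[U [_ <-]]; exact/dimvS/subvf.
case: (ex_maxnP exP ubP) => _ /asboolP[U [UA <-]] Umax.
exists U => x; split=> [xU|[Ax ANx]]; first by split; apply: UA; rewrite ?memvN.
suff /eqP -> : U == (U + <[x]>)%VS.
  by apply: (subvP (addvSr _ _)); exact: memv_line.
rewrite eqEdim addvSl /=; apply: Umax; apply/asboolP; exists (U + <[x]>)%VS.
split=> // _ /memv_addP[u uU [_ /vlineP[k ->] ->]]; apply: AD; first exact: UA.
have [k0|k0] := leP 0 k; first exact: AZ.
by rewrite -[k *: x]opprK -scaleNr -scalerN; apply: AZ => //; lra.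
Qed.

(** The span of a convex cone is the lineality space of the cone of its
    differences. *)
Lemma span_convex_cone V (A : set V) : convex_cone A ->
  exists N : {vspace V},
    forall x, x \in N <-> exists a b, [/\ A a, A b & x = a - b].
Proof.
move=> [A0 AD AZ].
have [|N hN] := @lineality_space V
    [set x | exists a b, [/\ A a, A b & x = a - b]].
  split=> [|_ _ [a [b [Aa Ab ->]]] [c [d [Ac Ad ->]]]
      |k _ k0 [a [b [Aa Ab ->]]]] /=.
  - by exists 0, 0; rewrite subrr.
  - exists (a + c), (b + d).
    by split; [exact: AD|exact: AD|rewrite opprD addrACA].
  - by exists (k *: a), (k *: b); split; [exact: AZ|exact: AZ|rewrite scalerBr].
exists N => x; split=> [/hN[]//|[a [b [Aa Ab ->]]]]; apply/hN; split=> /=.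
  by exists a, b.
by exists b, a; rewrite opprB.
Qed.

(** The projection along U, onto the complement chosen by [projv]. *)
Definition off_proj V (U : {vspace V}) : 'End(V) := (\1 - projv U)%VF.

Lemma off_projE V (U : {vspace V}) x : off_proj U x = x - projv U x.
Proof. by rewrite /off_proj add_lfunE opp_lfunE id_lfunE. Qed.

Lemma off_proj_id V (U : {vspace V}) x : x \in U -> off_proj U x = 0.
Proof. by move=> xU; rewrite off_projE projv_id ?subrr. Qed.

Lemma sub_off_proj V (U : {vspace V}) x : x - off_proj U x \in U.
Proof. by rewrite off_projE subKr memv_proj. Qed.

Definition coord_form V (i : 'I_(\dim {:V})) : dual V :=
  linfun (fun v => coords v 0 i : R^o).

Lemma coord_formE V i (v : V) : coord_form i v = coords v 0 i.
Proof.
by rewrite linfunP // => a x y; rewrite linearP !mxE.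
Qed.

Lemma coords_inj V (x y : V) : coords x = coords y -> x = y.
Proof. exact: (can_inj (@coordsK R V)). Qed.

Lemma dual_separates V (U : {vspace V}) x :
  (forall phi : dual V, (forall u, u \in U -> phi u = 0) -> phi x = 0) ->
  x \in U.
Proof.
move=> hx; suff e : off_proj U x = 0.
  by have := sub_off_proj U x; rewrite e subr0.
apply: coords_inj; apply/rowP => i.
rewrite linear0 [RHS]mxE -coord_formE -comp_lfunE.
by apply: hx => u uU; rewrite comp_lfunE off_proj_id // linear0.
Qed.

(** The forms phi1 - phi2 make up a subspace of the dual.  A vector on which
    they all vanish has x and - x in K by biduality, so it lies in U, where
    psi vanishes too. *)
Lemma lineality_dual V (K : set V) (U : {vspace V}) (psi : dual V) :
  closed_convex_cone K -> (forall x, x \in U <-> K x /\ K (- x)) ->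
  (forall u, u \in U -> psi u = 0) ->
  exists phi1 phi2, [/\ dual_cone K phi1, dual_cone K phi2 & psi = phi1 - phi2].
Proof.
move=> /closed_convex_coneP hK UK psiU.
have Kcone : convex_cone (dual_cone K).
  split=> [x _|phi1 phi2 h1 h2 x Kx|a phi a0 h x Kx].
  - by rewrite zero_lfunE.
  - by rewrite add_lfunE addr_ge0 ?h1 ?h2.
  - by rewrite scale_lfunE; apply: mulr_ge0 => //; apply: h.
have [W hW] := span_convex_cone Kcone; apply/hW.
apply: dual_separates => xi xiW.
have [bd _ bdK] := bidual_bij V; rewrite -(bdK xi) bidualE.
apply: psiU; apply/UK.
have zero phi : dual_cone K phi -> phi (bd xi) = 0.
  move=> hphi; rewrite -bidualE bdK; apply: xiW; apply/hW.
  by exists phi, 0; split=> //; [case: Kcone|rewrite subr0].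
by split; apply: hK => phi /zero e; rewrite ?linearN /= e ?oppr0.
Qed.

(** Each coordinate of the projection along U is a difference of two forms of
    the dual cone; the sum of all these forms dominates it.  Thus phi bounds
    the points of K up to the lines of K. *)
Lemma norming_form V (K : set V) (U : {vspace V}) :
  closed_convex_cone K -> (forall x, x \in U <-> K x /\ K (- x)) ->
  exists2 phi, dual_cone K phi &
    forall x, K x -> forall j, `|coords (off_proj U x) 0 j| <= phi x.
Proof.
move=> hK UK.
have /choice[f1 /choice[f2 hf]] j : exists phi1, exists phi2,
   [/\ dual_cone K phi1, dual_cone K phi2 &
       (coord_form j \o off_proj U)%VF = phi1 - phi2 :> dual V].
  by apply: (lineality_dual hK UK) => u uU;
    rewrite comp_lfunE off_proj_id ?linear0.
pose phi : dual V := \sum_j (f1 j + f2 j).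
have fge0 x j : K x -> 0 <= (f1 j + f2 j) x.
  by move=> Kx; have [h1 h2 _] := hf j; rewrite add_lfunE addr_ge0 ?h1 ?h2.
exists phi => [x Kx|x Kx j].
  by rewrite sum_lfunE; apply: sumr_ge0 => j _; apply: fge0.
rewrite -coord_formE -comp_lfunE; have [h1 h2 ->] := hf j.
apply: (@le_trans _ _ ((f1 j + f2 j) x)).
  rewrite !add_lfunE opp_lfunE.
  by rewrite (le_trans (ler_normB _ _)) // !ger0_norm ?h1 ?h2.
rewrite sum_lfunE (bigD1 j) //= lerDl.
by apply: sumr_ge0 => i _; apply: fge0.
Qed.

(** T is a union of rays, so the coefficients of a conic combination are
    absorbed in its terms, and as many terms as the dimension always suffice:
    more terms are linearly dependent. *)
Lemma conic_caratheodory V (T : set V) : T 0 ->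
  (forall a x, 0 <= a -> T x -> T (a *: x)) ->
  forall n (t : 'I_n -> V), (forall i, T (t i)) ->
  exists2 t' : 'I_(\dim {:V}) -> V,
    (forall i, T (t' i)) & \sum_i t i = \sum_i t' i.
Proof.
move=> T0 TZ n t Tt; elim: n => [|n IHn] in t Tt *.
  by exists (fun=> 0) => //; rewrite big_ord0 big1.
have [nN|nN] := leqP n.+1 (\dim {:V}).
  pose F j := oapp t 0 (insub j).
  exists (fun j => F (val j)) => [j|]; first by rewrite /F; case: insub => /=.
  have -> : \sum_i t i = \sum_(i < n.+1) F i.
    by apply: eq_bigr => i _; rewrite /F valK.
  rewrite (big_ord_widen _ F nN) big_mkcond /=; apply: eq_bigr => i _.
  by case: ifP => // ni; rewrite /F insubN //= ni.
have nfree : ~ free [tuple t i | i < n.+1].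
  rewrite /free => /eqP e; move: nN.
  rewrite ltnNge -{1}(size_tuple [tuple t i | i < n.+1]) -e.
  by rewrite dimvS ?subvf.
have [k [k_rel [i0 ki0]]] : exists k : 'I_n.+1 -> R,
    \sum_i k i *: t i = 0 /\ exists i, 0 < k i.
  have [k [k_rel [i ki]]] : exists k : 'I_n.+1 -> R,
      \sum_i k i *: t i = 0 /\ exists i, k i <> 0.
    apply: contrapT => H; apply: nfree; apply/freeP => k krel i.
    apply: contrapT => ki; apply: H.
    exists k; split; last by exists i.
    rewrite -[RHS]krel; apply: eq_bigr => j _.
    by rewrite -tnth_nth tnth_mktuple.
  have [ki0|ki0] := leP (k i) 0; last by exists k; split=> //; exists i.
  exists (fun i => - k i); split; last first.
    by exists i; rewrite oppr_gt0 lt_neqAle ki0 andbT; apply/eqP.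
  have -> : \sum_i - k i *: t i = - (\sum_i k i *: t i).
    by rewrite raddf_sum; apply: eq_bigr => j _; rewrite scaleNr.
  by rewrite k_rel oppr0.
(* Subtracting the multiple of the relation that makes the largest coefficient
   cancel keeps every other coefficient nonnegative. *)
case: (@arg_maxP _ R _ i0 xpredT k isT) => m _ kmax.
have km : 0 < k m by apply: lt_le_trans ki0 (kmax i0 isT).
pose s i := (1 - k i / k m) *: t i.
have sum_s : \sum_i t i = \sum_j s (lift m j).
  have <- : \sum_i s i = \sum_j s (lift m j).
    by rewrite (bigD1_ord m) //= {1}/s divff ?gt_eqF // subrr scale0r add0r.
  rewrite [RHS](_ : _ = \sum_i t i - (k m)^-1 *: \sum_i k i *: t i).
    by rewrite k_rel scaler0 subr0.
  rewrite scaler_sumr -sumrB; apply: eq_bigr => i _.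
  by rewrite /s scalerBl scale1r scalerA mulrC.
have [j|t' Tt' e] := IHn (fun j => s (lift m j)); last first.
  by exists t'; rewrite // sum_s.
by apply: TZ => //; rewrite subr_ge0 ler_pdivrMr // mul1r; apply: kmax.
Qed.

End ConvexCones.

(** * Minimal tensor products *)

Section TensorCones.
Context {R : realType}.
Implicit Types V W : vectType R.

Definition tensl V W (w : W) : 'Hom(V, V \ox W) :=
  linfun (fun v : V => v \ot w).
Definition tensr V W (v : V) : 'Hom(W, V \ox W) :=
  linfun (fun w : W => v \ot w).

Lemma tenslE V W (w : W) (v : V) : tensl V w v = v \ot w.
Proof. exact: (linfunP (tens_linl w)). Qed.

Lemma tensrE V W (v : V) (w : W) : tensr W v w = v \ot w.
Proof. exact: (linfunP (tens_linr v)). Qed.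

Lemma tens_scalel V W a (v : V) (w : W) : (a *: v) \ot w = a *: (v \ot w).
Proof. by rewrite -!tenslE linearZ. Qed.

Lemma tens_scaler V W a (v : V) (w : W) : v \ot (a *: w) = a *: (v \ot w).
Proof. by rewrite -!tensrE linearZ. Qed.

Lemma tensDl V W (v v' : V) (w : W) : (v + v') \ot w = v \ot w + v' \ot w.
Proof. by rewrite -!tenslE linearD. Qed.

Lemma tensDr V W (v : V) (w w' : W) : v \ot (w + w') = v \ot w + v \ot w'.
Proof. by rewrite -!tensrE linearD. Qed.

Lemma min_tensor_tens V W (A : set V) (B : set W) a b :
  A a -> B b -> min_tensor A B (a \ot b).
Proof. by move=> Aa Bb; exists 1, (fun=> a), (fun=> b); rewrite big_ord1. Qed.

Lemma min_tensor_sub V W (A A' : set V) (B B' : set W) :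
  A `<=` A' -> B `<=` B' -> min_tensor A B `<=` min_tensor A' B'.
Proof.
move=> sA sB _ [n [a [b [Aa Bb ->]]]]; exists n, a, b; split=> // i.
  exact: sA.
exact: sB.
Qed.

Lemma min_tensor_convex_cone V W (A : set V) (B : set W) :
  convex_cone A -> convex_cone (min_tensor A B).
Proof.
move=> [_ _ AZ]; split=> [|_ _ [n [a [b [Aa Bb ->]]]] [m [c [d [Ac Bd ->]]]]|].
- by exists 0, (fun=> 0), (fun=> 0); rewrite big_ord0; split=> // -[].
- pose ac (i : 'I_(n + m)) :=
    match fintype.split i with inl j => a j | inr j => c j end.
  pose bd (i : 'I_(n + m)) :=
    match fintype.split i with inl j => b j | inr j => d j end.
  exists (n + m)%N, ac, bd; split=> [i|i|]; rewrite ?/ac ?/bd;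
    try by case: fintype.split.
  rewrite big_split_ord /=; congr (_ + _); apply: eq_bigr => i _.
    by rewrite -[lshift _ _]/(unsplit (inl i)) unsplitK.
  by rewrite -[rshift _ _]/(unsplit (inr i)) unsplitK.
- move=> k _ k0 [n [a [b [Aa Bb ->]]]]; exists n, (fun i => k *: a i), b.
  split=> // [i|]; first exact: AZ.
  by rewrite scaler_sumr; apply: eq_bigr => i _; rewrite tens_scalel.
Qed.

Lemma dual_cone_min_tensor V W (A : set V) (B : set W) (phi : dual (V \ox W)) :
  dual_cone (min_tensor A B) phi <->
  forall a b, A a -> B b -> 0 <= phi (a \ot b).
Proof.
split=> [h a b Aa Bb|h _ [n [a [b [Aa Bb ->]]]]].
  by apply: h; apply: min_tensor_tens.
by rewrite linear_sum sumr_ge0 // => i _; apply: h.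
Qed.

Lemma convex_coneT V : convex_cone [set: V].
Proof. by []. Qed.

(** The sums of pure tensors form a subspace, and a form that vanishes on pure
    tensors is 0. *)
Lemma tensor_sum V W (z : V \ox W) : min_tensor setT setT z.
Proof.
have [U hU] :=
  lineality_space (@min_tensor_convex_cone V W _ setT (@convex_coneT V)).
suff /hU[] : z \in U by [].
apply: dual_separates => phi phiU.
suff -> : phi = 0 :> 'Hom(V \ox W, R^o) by rewrite zero_lfunE.
apply: tensor_ext => v w; rewrite zero_lfunE; apply: phiU; apply/hU.
split; first exact: min_tensor_tens.
by rewrite -scaleN1r -tens_scalel; apply: min_tensor_tens.
Qed.

Lemma compact_slice V (K : set V) (phi : dual V) (M : R) :
  closed_convex_cone K ->
  (forall x, K x -> forall j, `|coords x 0 j| <= phi x) ->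
  compact (@coords R V @` [set x | K x /\ phi x <= M]).
Proof.
move=> [_ Kcl] hphi; apply: bounded_closed_compact.
  exists `|M|; split; first exact: num_real.
  move=> N MN _ [x [Kx xM] <-].
  rewrite /Num.Def.normr /= mx_normrE; apply/bigmax_leP; split=> [|[i j] _ /=].
    exact: le_trans (normr_ge0 M) (ltW MN).
  rewrite (ord1 i); apply: le_trans (ltW MN); apply: le_trans (ler_norm M).
  exact: le_trans (hphi x Kx j) xM.
have -> : @coords R V @` [set x | K x /\ phi x <= M] =
    @coords R V @` K `&` (fun p => phi (uncoords p)) @^-1` [set r | r <= M].
  apply/seteqP; split=> p.
    by move/coords_img => [Kp pM]; split=> //; apply/coords_img.
  by move=> [/coords_img Kp pM]; apply/coords_img.
apply: closedI => //; apply: (continuous_closedP _).1; last exact: closed_le.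
by apply: (@linear_rV_continuous _ _ R^o) => a p q; rewrite !linearP.
Qed.

Lemma tens_coords_continuous V W :
  continuous (fun pq : 'rV[R]_(\dim {:V}) * 'rV[R]_(\dim {:W}) =>
    coords (uncoords pq.1 \ot uncoords pq.2)).
Proof.
pose c i j := coords ((vbasis {:V})`_i \ot (vbasis {:W})`_j).
have -> : (fun pq : 'rV[R]_(\dim {:V}) * 'rV[R]_(\dim {:W}) =>
    coords (uncoords pq.1 \ot uncoords pq.2)) =
    fun pq => \sum_(i < \dim {:V}) \sum_(j < \dim {:W})
      (pq.1 0 i * pq.2 0 j) *: c i j.
  apply/funext => -[p q] /=.
  rewrite -tenslE {1}/uncoords /passmx.vecof !linear_sum; apply: eq_bigr => i _.
  rewrite linearZ /= tenslE -tensrE /uncoords /passmx.vecof !linear_sum.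
  apply: eq_bigr => j _.
  by rewrite /= tensrE tens_scaler !linearZ /= scalerA.
apply: continuous_big => [|i _]; first exact: add_continuous.
apply: continuous_big => [|j _ pq]; first exact: add_continuous.
have c1 : {for pq,
    continuous (fun x : 'rV[R]_(\dim {:V}) * 'rV[R]_(\dim {:W}) => x.1 0 i)}.
  apply: (@continuous_comp _ _ _ fst (fun p : 'rV[R]_(\dim {:V}) => p 0 i)).
    exact: (cvg_fst (F := nbhs pq.1) (G := nbhs pq.2)).
  exact: (@coord_continuous R 1 _ 0 i).
have c2 : {for pq,
    continuous (fun x : 'rV[R]_(\dim {:V}) * 'rV[R]_(\dim {:W}) => x.2 0 j)}.
  apply: (@continuous_comp _ _ _ snd (fun p : 'rV[R]_(\dim {:W}) => p 0 j)).
    exact: (cvg_snd (F := nbhs pq.1) (G := nbhs pq.2)).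
  exact: (@coord_continuous R 1 _ 0 j).
exact: (cvgZr_tmp (cvgM c1 c2)).
Qed.

Definition sum_set n (U : nmodType) (T : set U) : set U :=
  [set x | exists2 t : 'I_n -> U, (forall i, T (t i)) & x = \sum_i t i].

Lemma compact_sum_set n (U : normedModType R) (T : set U) :
  compact T -> compact (sum_set n T).
Proof.
move=> Tc; elim: n => [|n IHn].
  rewrite (_ : sum_set 0 T = [set 0]); first exact: compact_set1.
  apply/seteqP; split=> x; first by move=> [t _ ->]; rewrite big_ord0.
  by move=> /= ->; exists (fun=> 0); [case|rewrite big_ord0].
rewrite (_ : sum_set n.+1 T =
    (fun p : U * U => p.1 + p.2) @` (T `*` sum_set n T)).
  apply: continuous_compact; last exact: compact_setX.
  by apply: continuous_subspaceT; exact: add_continuous.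
apply/seteqP; split=> x.
  move=> [t Tt ->]; exists (t ord0, \sum_(i < n) t (lift ord0 i)) => /=.
    by split=> //=; exists (fun i => t (lift ord0 i)).
  by rewrite big_ord_recl.
move=> [[a _]] /= [Ta [t Tt ->]] <-.
exists (fun i => oapp t a (unlift ord0 i)) => [i|]; first by case: unlift.
rewrite big_ord_recl unlift_none /=; congr (_ + _).
by apply: eq_bigr => i _; rewrite liftK.
Qed.

(** Near z, only the elements y of the tensor product with
    (phi (x) psi) y <= M matter.  Each is a sum of dim (V (x) W) pure tensors
    a (x) b, and after moving the scalar phi a to the second factor,
    phi a <= 1 and psi b <= M.  Such pure tensors form a compact set T, and
    the sums of a fixed number of elements of T form a compact set, which is
    closed. *)
Lemma salient_min_tensor_closed V W (K : set V) (B : set W)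
    (phi : dual V) (psi : dual W) :
  closed_convex_cone K -> closed_convex_cone B ->
  (forall x, K x -> forall j, `|coords x 0 j| <= phi x) -> dual_cone K phi ->
  (forall y, B y -> forall j, `|coords y 0 j| <= psi y) -> dual_cone B psi ->
  vclosure (min_tensor K B) `<=` min_tensor K B.
Proof.
move=> hK hB Kphi phi0 Bpsi psi0 z zcl.
have [[K0 KD KZ] _] := hK; have [[B0 BD BZ] _] := hB.
pose theta : dual (V \ox W) := tdual V W (phi \ot psi).
pose M := theta z + 1.
pose T : set 'rV[R]_(\dim {:V \ox W}) :=
  (fun pq => coords (uncoords pq.1 \ot uncoords pq.2)) @`
  ((@coords R V @` [set x | K x /\ phi x <= 1]) `*`
   (@coords R W @` [set y | B y /\ psi y <= M])).
have Tc : compact T.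
  apply: continuous_compact.
    by apply: continuous_subspaceT; exact: tens_coords_continuous.
  by apply: compact_setX; apply: compact_slice.
have Scl : closed (sum_set (\dim {:V \ox W}) T).
  by apply: compact_closed; [exact: norm_hausdorff|exact: compact_sum_set].
have pureT a b : K a -> B b -> phi a * psi b <= M -> T (coords (a \ot b)).
  move=> Ka Bb abM.
  (* phi a = 0 forces a = 0, because phi bounds the coordinates of a. *)
  have [a0|a0] := eqVneq (phi a) 0.
    have -> : a \ot b = 0 \ot 0.
      have -> : a = 0.
        apply: coords_inj; apply/rowP => j; rewrite linear0 [RHS]mxE.
        by apply/eqP; rewrite -normr_le0 -a0 Kphi.
      by rewrite -!tenslE !linear0.
    exists (coords (0 : V), coords (0 : W)); last by rewrite /= !coordsK.
    split; [exists 0|exists 0] => //; split=> //; rewrite linear0 //.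
    by apply: le_trans abM; rewrite a0 mul0r.
  exists (coords ((phi a)^-1 *: a), coords (phi a *: b)).
    split; [exists ((phi a)^-1 *: a)|exists (phi a *: b)] => //; split.
    - by apply: KZ => //; rewrite invr_ge0 phi0.
    - by rewrite linearZ /= -[_ *: _]/(_ * _) mulVf.
    - by apply: BZ => //; rewrite phi0.
    - by rewrite linearZ.
  by rewrite /= !coordsK tens_scalel tens_scaler scalerA mulVf // scale1r.
have sumT y : min_tensor K B y -> theta y <= M ->
    sum_set (\dim {:V \ox W}) T (coords y).
  move=> [n [a [b [Ka Bb ->]]]] yM.
  pose P : set (V \ox W) := [set t | exists a b, [/\ K a, B b & t = a \ot b]].
  have [||i|t Pt e] := @conic_caratheodory R _ P _ _ n (fun i => a i \ot b i).
  - by exists 0, 0; split=> //; rewrite -tenslE linear0.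
  - move=> k _ k0 [x [y' [Kx By ->]]]; exists (k *: x), y'.
    by rewrite tens_scalel; split=> //; apply: KZ.
  - by exists (a i), (b i).
  have tge0 i : 0 <= theta (t i).
    by have [x [y' [Kx By ->]]] := Pt i;
      rewrite tdual_tens mulr_ge0 ?phi0 ?psi0.
  exists (fun i => coords (t i)); last by rewrite e linear_sum.
  move=> i; have [x [y' [Kx By txy]]] := Pt i; rewrite txy; apply: pureT => //.
  rewrite -tdual_tens -/theta -txy; apply: le_trans yM.
  by rewrite e linear_sum (bigD1 i) //= lerDl sumr_ge0.
suff : sum_set (\dim {:V \ox W}) T (coords z).
  move=> [t Tt zt]; rewrite -(coordsK z) zt linear_sum.
  have [_ MD _] := @min_tensor_convex_cone V W K B hK.1.
  have M0 : min_tensor K B 0 by have [] := @min_tensor_convex_cone V W K B hK.1.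
  elim/big_ind: _ => // i _.
  have [[p q] [/= /coords_img [Kp _] /coords_img [Bq _]] <-] := Tt i.
  by rewrite coordsK; apply: min_tensor_tens.
apply: Scl => O zO.
have thc : continuous (fun p => theta (uncoords p) : R).
  by apply: (@linear_rV_continuous _ _ R^o) => a p q; rewrite !linearP.
have near_z :
    nbhs (coords z) ((fun p => theta (uncoords p)) @^-1` [set r | r < M]).
  apply: thc; rewrite /= coordsK; apply: open_nbhs_nbhs.
  split; first exact: open_lt.
  by rewrite /= /M ltrDl.
have [p [/coords_img yp [Op pM]]] := zcl _ (filterI zO near_z).
exists p; split=> //; rewrite -(uncoordsK p); apply: sumT => //.
exact: ltW.
Qed.

End TensorCones.

(** * Closedness of the minimal tensor product *)

Section MinTensorClosed.
Context {R : realType}.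
Implicit Types V W : vectType R.

Lemma vanishing_dual V (x : V) :
  (forall phi : dual V, phi x = 0) -> x = 0.
Proof.
move=> hx; apply/eqP; rewrite -memv0; apply: dual_separates => phi _; exact: hx.
Qed.

Lemma tmap_comp V V2 V3 W W2 W3 (f : 'Hom(V, V2)) (g : 'Hom(V2, V3))
    (h : 'Hom(W, W2)) (k : 'Hom(W2, W3)) z :
  tmap g k (tmap f h z) = tmap (g \o f)%VF (k \o h)%VF z.
Proof.
rewrite -comp_lfunE; congr (fun_of_lfun _ z); apply: tensor_ext => v w.
by rewrite comp_lfunE !tmap_tens !comp_lfunE.
Qed.

Section Bipolar.
Variables (V W : vectType R) (K : set V) (B : set W) (z : V \ox W).
Hypotheses (hK : closed_convex_cone K) (hB : closed_convex_cone B).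

Definition in_bipolar (z : V \ox W) :=
  forall theta : dual (V \ox W), dual_cone (min_tensor K B) theta ->
    0 <= theta z.

(** Any form composed with f (x) g - 1 vanishes on the pure tensors a (x) b,
    so it and its opposite both lie in the dual cone, and both are nonnegative
    at z. *)
Lemma tmap_fix (f : 'End(V)) (g : 'End(W)) : in_bipolar z ->
  (forall a, K a -> f a = a) -> (forall b, B b -> g b = b) -> tmap f g z = z.
Proof.
move=> hz fK gB; apply/eqP; rewrite -subr_eq0; apply/eqP/vanishing_dual => phi.
pose h : dual (V \ox W) := (phi \o (tmap f g - \1))%VF.
have h0 a b : K a -> B b -> h (a \ot b) = 0.
  move=> Ka Bb; rewrite comp_lfunE add_lfunE opp_lfunE id_lfunE tmap_tens.
  by rewrite fK // gB // subrr linear0.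
have hE : phi (tmap f g z - z) = h z.
  by rewrite comp_lfunE add_lfunE opp_lfunE id_lfunE.
apply/eqP; rewrite hE eq_le; apply/andP; split; last first.
  by apply: hz; apply/dual_cone_min_tensor => a b Ka Bb; rewrite h0.
rewrite -oppr_ge0 -opp_lfunE; apply: hz.
apply/dual_cone_min_tensor => a b Ka Bb.
by rewrite opp_lfunE h0 // oppr0.
Qed.

Lemma tmap_min_tensor (f : 'End(V)) (g : 'End(W)) :
  (forall v w, min_tensor K B (f v \ot g w)) -> min_tensor K B (tmap f g z).
Proof.
have [M0 MD _] := @min_tensor_convex_cone R V W K B hK.1.
move=> fg; have [n [a [b [_ _ ->]]]] := tensor_sum z.
rewrite linear_sum; elim/big_ind: _ => // i _; rewrite /= tmap_tens; exact: fg.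
Qed.

End Bipolar.

Lemma min_tensor_diffr V W (K : set V) (B : set W) u y :
  convex_cone K -> K u -> K (- u) -> (exists a b, [/\ B a, B b & y = a - b]) ->
  min_tensor K B (u \ot y).
Proof.
move=> hK Ku KNu [a [b [Ba Bb ->]]].
have [_ MD _] := @min_tensor_convex_cone R V W K B hK.
have -> : u \ot (a - b) = u \ot a + (- u) \ot b.
  by rewrite -[- u]scaleN1r tens_scalel scaleN1r -!tensrE linearB.
by apply: MD; apply: min_tensor_tens.
Qed.

Lemma min_tensor_diffl V W (K : set V) (B : set W) x u :
  convex_cone K -> B u -> B (- u) -> (exists a b, [/\ K a, K b & x = a - b]) ->
  min_tensor K B (x \ot u).
Proof.
move=> hK Bu BNu [a [b [Ka Kb ->]]].
have [_ MD _] := @min_tensor_convex_cone R V W K B hK.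
have -> : (a - b) \ot u = a \ot u + b \ot (- u).
  by rewrite -[- u]scaleN1r tens_scaler scaleN1r -!tenslE linearB.
by apply: MD; apply: min_tensor_tens.
Qed.

Lemma closed_convex_cone_complement V (K : set V) (U : {vspace V}) :
  closed_convex_cone K -> closed_convex_cone (K `&` [set x | off_proj U x = x]).
Proof.
move=> /closed_convex_coneP hK; apply/closed_convex_coneP => x hx; split.
  by apply: hK => phi hphi; apply: hx => y [Ky _]; apply: hphi.
apply/eqP; rewrite -subr_eq0; apply/eqP/vanishing_dual => phi.
pose h : dual V := (phi \o (off_proj U - \1))%VF.
have hE y : h y = phi (off_proj U y - y).
  by rewrite comp_lfunE add_lfunE opp_lfunE id_lfunE.
apply/eqP; rewrite -hE eq_le -oppr_ge0 -opp_lfunE.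
apply/andP; split; apply: hx => y [_ /= yU].
  by rewrite opp_lfunE hE yU subrr linear0 oppr0.
by rewrite hE yU subrr linear0.
Qed.

Lemma off_proj_cone V (K : set V) (U : {vspace V}) x : convex_cone K ->
  (forall x, x \in U <-> K x /\ K (- x)) -> K x -> K (off_proj U x).
Proof.
move=> [_ KD _] hU Kx; rewrite off_projE; apply: KD => //.
by have /hU[] := memv_proj U x.
Qed.

Lemma off_projK V (U : {vspace V}) x : off_proj U (off_proj U x) = off_proj U x.
Proof.
by rewrite [LHS]off_projE off_projE linearB /= projv_proj subrr subr0.
Qed.

(** With P and Q the projections along the spaces of lines of K and of B,
    z = (P (x) Q) z + ((1 - P) (x) 1) z + (P (x) (1 - Q)) z.  The first term
    is handled by the salient cones P K and Q B, which are contained in K and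
    B.  In the second, the left factors run over a subspace of K; the right
    factors can be taken in the span of B, since the projection onto this span
    fixes z; and u (x) (b - b') = u (x) b + (- u) (x) b'.  The third is
    similar. *)
Lemma closed_convex_cone_min_tensor V W (K : set V) (B : set W) :
  closed_convex_cone K -> closed_convex_cone B ->
  closed_convex_cone (min_tensor K B).
Proof.
move=> hK hB; apply/closed_convex_coneP => z hz.
have [U hU] := lineality_space hK.1; have [M hM] := lineality_space hB.1.
pose P := off_proj U; pose Q := off_proj M.
pose K0 := K `&` [set x | P x = x]; pose B0 := B `&` [set y | Q y = y].
have hK0 : closed_convex_cone K0 by exact: closed_convex_cone_complement.
have hB0 : closed_convex_cone B0 by exact: closed_convex_cone_complement.
have PK a : K a -> K (P a) by apply: off_proj_cone => //; case: hK.
have QB b : B b -> B (Q b) by apply: off_proj_cone => //; case: hB.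
have [M0 MD _] := @min_tensor_convex_cone R V W K B hK.1.
have zPQ : min_tensor K B (tmap P Q z).
  apply: (@min_tensor_sub R _ _ K0 K B0 B); [by move=> x []|by move=> x []|].
  have [phi phi0 hphi] := norming_form hK hU.
  have [psi psi0 hpsi] := norming_form hB hM.
  apply: (@salient_min_tensor_closed R V W K0 B0 phi psi) => //.
  - by move=> x [Kx Px] j; rewrite -[in X in coords X]Px hphi.
  - by move=> x [Kx _]; apply: phi0.
  - by move=> y [By Qy] j; rewrite -[in X in coords X]Qy hpsi.
  - by move=> y [By _]; apply: psi0.
  apply: bipolar => [|theta htheta]; first exact/min_tensor_convex_cone/hK0.1.
  rewrite -comp_lfunE; apply: hz; apply/dual_cone_min_tensor => a b Ka Bb.
  rewrite comp_lfunE tmap_tens; apply: htheta; apply: min_tensor_tens.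
    by split; [exact: PK|exact: off_projK].
  by split; [exact: QB|exact: off_projK].
have [NK hNK] := span_convex_cone hK.1; have [NB hNB] := span_convex_cone hB.1.
have KNK a : K a -> a \in NK.
  by move=> Ka; apply/hNK; exists a, 0; rewrite subr0; case: (hK) => -[].
have BNB b : B b -> b \in NB.
  by move=> Bb; apply/hNB; exists b, 0; rewrite subr0; case: (hB) => -[].
have zU : min_tensor K B (tmap (projv U) \1%VF z).
  rewrite -(@tmap_fix _ _ _ _ _ \1%VF (projv NB) hz); last 2 first.
  - by move=> a _; rewrite id_lfunE.
  - by move=> b /BNB; exact: projv_id.
  rewrite tmap_comp comp_lfun1r comp_lfun1l; apply: tmap_min_tensor => // v w.
  have /hU[] := memv_proj U v => h1 h2.
  by apply: min_tensor_diffr => //; [case: hK|apply/hNB; exact: memv_proj].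
have zM : min_tensor K B (tmap P (projv M) z).
  have hz' : in_bipolar K B (tmap P \1%VF z).
    move=> theta htheta; rewrite -comp_lfunE; apply: hz.
    apply/dual_cone_min_tensor => a b Ka Bb.
    rewrite comp_lfunE tmap_tens id_lfunE; apply: htheta.
    by apply: min_tensor_tens => //; exact: PK.
  have -> : tmap P (projv M) z = tmap (projv NK) (projv M) (tmap P \1%VF z).
    have e := @tmap_fix _ _ _ _ _ (projv NK) \1%VF hz'.
    transitivity (tmap \1%VF (projv M) (tmap P \1%VF z)).
      by rewrite tmap_comp comp_lfun1l comp_lfun1r.
    rewrite -{1}e; first by rewrite tmap_comp comp_lfun1l comp_lfun1r.
      by move=> a /KNK; exact: projv_id.
    by move=> b _; rewrite id_lfunE.
  apply: tmap_min_tensor => // v w; have /hM[] := memv_proj M w => h1 h2.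
  by apply: min_tensor_diffl => //; [case: hK|apply/hNK; exact: memv_proj].
suff -> : z = tmap P Q z + tmap (projv U) \1%VF z + tmap P (projv M) z.
  by apply: (MD); first exact: (MD).
rewrite -!add_lfunE -[LHS](id_lfunE z); congr (fun_of_lfun _ z).
apply: tensor_ext => v w; rewrite !add_lfunE !tmap_tens !id_lfunE.
rewrite addrAC -tensDr /P /Q [off_proj M w]off_projE subrK.
by rewrite -tensDl off_projE subrK.
Qed.

End MinTensorClosed.

(** * Perfect pairings *)

Section Pairings.
Context {R : realType}.
Implicit Types V W : vectType R.

Lemma tmapE V V2 W W2 (f : 'Hom(V, V2)) (g : 'Hom(W, W2)) (t : V \ox W)
    (psi : dual V2) :
  tmap f g t psi = g (t (psi \o f)%VF).
Proof.
have [n [a [b [_ _ ->]]]] := tensor_sum t.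
rewrite linear_sum !sum_lfunE linear_sum; apply: eq_bigr => i _.
by rewrite /= tmap_tens !tensE linearZ comp_lfunE.
Qed.

Lemma tdualE V W (t : dual V \ox dual W) v w :
  tdual V W t (v \ot w) = t (bidual V v) w.
Proof.
have [n [a [b [_ _ ->]]]] := tensor_sum t.
rewrite linear_sum !sum_lfunE; apply: eq_bigr => i _.
by rewrite /= tdual_tens tensE scale_lfunE bidualE.
Qed.

Lemma lfun_bij V W (f : 'Hom(V, W)) :
  injective f -> \dim {:V} = \dim {:W} -> bijective f.
Proof.
move=> /lker0P k0 e; exists (f^-1)%VF => [v|]; first exact: lker0_lfunK.
suff lim : limg f = fullv by move=> p; rewrite limg_lfunVK // lim memvf.
apply/eqP; rewrite eqEdim subvf limg_dim_eq; last by rewrite (eqP k0) capv0.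
by rewrite e /=.
Qed.

Lemma tdual_bij V W : bijective (tdual V W).
Proof.
apply: lfun_bij => [t t' tt'|].
  apply/lfunP => xi; apply/lfunP => w; have [bd _ bdK] := bidual_bij V.
  by rewrite -(bdK xi) -!tdualE tt'.
have dimE (U : vectType R) : dim (dual U) = dim U by rewrite /dim /= muln1.
have dimT (U U' : vectType R) : dim (tensor U U') = (dim (dual U) * dim U')%N.
  by [].
by rewrite !dimvf !(dimE, dimT).
Qed.

Lemma tmap_bij V V2 W W2 (f : 'Hom(V, V2)) (g : 'Hom(W, W2)) :
  bijective f -> bijective g -> bijective (tmap f g).
Proof.
have inv (U U2 : vectType R) (h : 'Hom(U, U2)) : bijective h ->
    (h^-1 \o h = \1)%VF /\ (h \o h^-1 = \1)%VF.
  move=> hb; have h0 : lker h == 0%VS by apply/lker0P/bij_inj.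
  have hK : cancel h (h^-1)%VF by exact: lker0_lfunK.
  split; apply/lfunP => x; rewrite comp_lfunE id_lfunE ?hK //.
  by have [k _ kK] := hb; rewrite -(kK x) hK.
move=> /inv[f1 f2] /inv[g1 g2]; exists (tmap (f^-1) (g^-1))%VF => t.
  rewrite tmap_comp f1 g1; apply/lfunP => psi.
  by rewrite tmapE id_lfunE comp_lfun1r.
rewrite tmap_comp f2 g2; apply/lfunP => psi.
by rewrite tmapE id_lfunE comp_lfun1r.
Qed.

Lemma tmap1 V W (t : V \ox W) : tmap \1%VF \1%VF t = t.
Proof. by apply/lfunP => psi; rewrite tmapE id_lfunE comp_lfun1r. Qed.

Section PerfectPairing.
Variables (V W : vectType R) (T : 'Hom(V, dual W)).
Hypothesis T_bij : bijective T.

(** A form on V, transported to the dual of W by T, is an element of the bidual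
    of W. *)
Lemma pairing_represents (phi : dual V) : exists w, forall v, phi v = T v w.
Proof.
have T0 : lker T == 0%VS by apply/lker0P/bij_inj.
have [bd _ bdK] := bidual_bij W.
exists (bd (phi \o T^-1)%VF) => v.
by rewrite -[RHS]bidualE bdK comp_lfunE lker0_lfunK.
Qed.

Lemma pairing_polar_l (Q : set V) z : closed_convex_cone Q ->
  (forall w, (forall v, Q v -> 0 <= T v w) -> 0 <= T z w) -> Q z.
Proof.
move=> /closed_convex_coneP hQ hz; apply: hQ => phi hphi.
have [w wE] := pairing_represents phi.
by rewrite wE; apply: hz => v Qv; rewrite -wE; apply: hphi.
Qed.

Lemma pairing_polar_r (Q : set W) z : closed_convex_cone Q ->
  (forall v, (forall w, Q w -> 0 <= T v w) -> 0 <= T v z) -> Q z.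
Proof.
move=> /closed_convex_coneP hQ hz; apply: hQ => psi hpsi.
have [Ti _ TiK] := T_bij; rewrite -(TiK psi); apply: hz => w.
by rewrite TiK; exact: hpsi.
Qed.

End PerfectPairing.
End Pairings.

(** * Double duals in a star autonomous category *)

Section DoubleDual.
Context {C : starcat}.

(** The image of the identity under C(a, c) = C(a (x) 1, c)
    = C(a, star (1 (x) star c)) = C(a, star (star c)), for a = c. *)
Definition double_dual_unit (c : C) : chom c (star (star c)) :=
  starh (lunitorV (star c)) \c scurry (runitor c).

(** The bijection C(a, c) = C(a, star (star c)) is composition with the unit,
    by naturality in a. *)
Lemma double_dual_unit_comp (a c : C) (h : chom a c) :
  double_dual_unit c \c h =
    starh (lunitorV (star c)) \c scurry (h \c runitor a).
Proof. by rewrite /double_dual_unit -compcA -scurry_natl runitor_nat. Qed.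

(** As composition with the unit is bijective for every source, the unit is an
    isomorphism (Yoneda). *)
Lemma double_dual_unit_retraction (c : C) :
  exists j : chom (star (star c)) c, j \c double_dual_unit c = idc c.
Proof.
have lK : starh (lunitorV (star c)) \c starh (lunitor (star c)) = idc _.
  by rewrite -starh_comp lunitorVK starh_id.
have lVK : starh (lunitor (star c)) \c starh (lunitorV (star c)) = idc _.
  by rewrite -starh_comp lunitorK starh_id.
have [k _ kK] := scurry_bij (star (star c)) cunit c.
pose j := k (starh (lunitor (star c))) \c runitorV (star (star c)).
have ij : double_dual_unit c \c j = idc _.
  rewrite double_dual_unit_comp /j -compcA runitorK compc_idr kK; exact: lK.
exists j.
have inj : forall h h' : chom c c,
    double_dual_unit c \c h = double_dual_unit c \c h' -> h = h'.
  move=> h h'; rewrite !double_dual_unit_comp => e.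
  have /(bij_inj (scurry_bij _ _ _)) e' :
      scurry (h \c runitor c) = scurry (h' \c runitor c).
    rewrite -[LHS]compc_idl -[RHS]compc_idl -lVK -!compcA; congr (_ \c _).
    exact: e.
  by rewrite -[h]compc_idr -[h']compc_idr -!(runitorVK c) !compcA e'.
by apply: inj; rewrite compcA ij compc_idl compc_idr.
Qed.

End DoubleDual.

Arguments dual_family {R C S X} G c.
Arguments min_family {R C} S {X} K c.
Arguments max_family {R C} S {X} K c.
Arguments add_family {R C S X} G E c.
Arguments cap_family {R C S X} G E c.
Arguments preim_family {R C S X Y} Psi D c.
Arguments im_family {R C S X Y} Psi G c.

Section Stem.
Context {R : realType} {C : starcat} (S : stem R C).
Implicit Types (X Y Z : vectType R) (c d : C).

(** The stem sends c -> star (star c) to the canonical map into the bidual,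
    read through the identifications of S (star c) with (S c)'. *)
Lemma sdelta_double_dual_unit c u s :
  sdelta S (star c) (stem_map S (double_dual_unit c) u) s = sdelta S c s u.
Proof.
rewrite /double_dual_unit stem_map_comp comp_lfunE sdelta_nat.
have -> : stem_map S (lunitorV (star c)) s =
    smu S cunit (star c) (seps S 1 \ot s).
  rewrite -[in LHS](smu_lunit s) -comp_lfunE -stem_map_comp lunitorK
    stem_map_id.
  by rewrite id_lfunE.
by rewrite stem_scurry smu_runit.
Qed.

Lemma sdelta_trE c u s : sdelta_tr S c u s = sdelta S c s u.
Proof. by rewrite comp_lfunE dual_mapE bidualE. Qed.

Lemma sdelta_tr_bij c : bijective (sdelta_tr S c).
Proof.
apply: lfun_bij => [u u' uu'|].
  apply/eqP; rewrite -subr_eq0; apply/eqP/vanishing_dual => phi.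
  have [k _ kK] := sdelta_bij S c; rewrite linearB /= -(kK phi).
  by rewrite -!sdelta_trE uu' subrr.
have dimE (U : vectType R) : dim (dual U) = dim U by rewrite /dim /= muln1.
have [k _ kK'] := sdelta_bij S c.
have : \dim {:S (star c)} = \dim {:dual (S c)}.
  have l0 : lker (sdelta S c) == 0%VS by apply/lker0P/bij_inj/sdelta_bij.
  have -> : {:dual (S c)}%VS = limg (sdelta S c).
    by apply/vspaceP => phi; rewrite memvf -(kK' phi) memv_img ?memvf.
  by rewrite limg_dim_eq // (eqP l0) capv0.
by rewrite !dimvf !dimE => ->.
Qed.

(** The pairing whose polar is the dual family. *)
Definition spair X c : 'Hom(dual X \ox S c, dual (X \ox S (star c))) :=
  (tdual X (S (star c)) \o tmap \1 (sdelta_tr S c))%VF.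

Lemma dual_familyE X (G : sfamily S X) c z :
  dual_family G c z <-> forall y, G (star c) y -> 0 <= spair X c z y.
Proof. by rewrite /spair; split=> h y /h; rewrite comp_lfunE. Qed.

Lemma spair_tens X c phi u y :
  spair X c (phi \ot u) y = sdelta S c ((y : 'Hom(dual X, S (star c))) phi) u.
Proof.
have [n [a [b [_ _ ->]]]] := tensor_sum y.
rewrite sum_lfunE !linear_sum sum_lfunE; apply: eq_bigr => i _ /=.
by rewrite comp_lfunE tmap_tens id_lfunE tdual_tens sdelta_trE tensE linearZ
  scale_lfunE.
Qed.

Lemma spair_bij X c : bijective (spair X c).
Proof.
have h : bijective (tdual X (S (star c)) \o tmap \1%VF (sdelta_tr S c)).
  apply: bij_comp; first exact: tdual_bij.
  apply: tmap_bij; last exact: sdelta_tr_bij.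
  by exists id => x; rewrite id_lfunE.
by apply: (eq_bij h) => z; rewrite /spair comp_lfunE.
Qed.

Lemma spair_ext X X2 c c2 y y2 (f : 'Hom(dual X \ox S c, dual X2 \ox S c2)) z :
  (forall phi u, spair X2 c2 (f (phi \ot u)) y2 = spair X c (phi \ot u) y) ->
  spair X2 c2 (f z) y2 = spair X c z y.
Proof.
move=> h; have [n [a [b [_ _ ->]]]] := tensor_sum z.
by rewrite !linear_sum !sum_lfunE; apply: eq_bigr => i _ /=; rewrite h.
Qed.

Lemma spair_nat X c d (Phi : chom c d) z y :
  spair X d (tmap \1%VF (stem_map S Phi) z) y =
  spair X c z (tmap \1%VF (stem_map S (starh Phi)) y).
Proof.
apply: spair_ext => phi u.
by rewrite tmap_tens !spair_tens id_lfunE tmapE comp_lfun1r sdelta_nat.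
Qed.

Lemma spair_dual_map X Y c (Psi : 'Hom(X, Y)) z y :
  spair X c (tmap (dual_map Psi) \1%VF z) y = spair Y c z (tmap Psi \1%VF y).
Proof.
apply: spair_ext => phi u; rewrite tmap_tens !spair_tens tmapE !id_lfunE.
congr (sdelta S c (_ _) u); apply/lfunP => x.
by rewrite dual_mapE comp_lfunE.
Qed.

(** Symmetry of the pairing: exchanging the two sides costs one double dual on
    X and one on c. *)
Lemma spair_bidual X c (x : X \ox S c) y :
  spair (dual X) c (tmap (bidual X) \1%VF x) y =
  spair X (star c) y (tmap \1%VF (stem_map S (double_dual_unit c)) x).
Proof.
have [n [a [b [_ _ ->]]]] := tensor_sum x.
rewrite !linear_sum !sum_lfunE; apply: eq_bigr => i _ /=.
have [m [p [q [_ _ ->]]]] := tensor_sum y.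
rewrite !linear_sum !sum_lfunE; apply: eq_bigr => j _ /=.
rewrite !tmap_tens !spair_tens !id_lfunE !tensE bidualE.
by rewrite !linearZ !scale_lfunE sdelta_double_dual_unit.
Qed.

End Stem.

(** * Duality of systems *)

Section Systems.
Context {R : realType} {C : starcat} (S : stem R C).
Implicit Types (X Y Z : vectType R) (c d : C).

Lemma family_ext X (G E : sfamily S X) : (forall c z, G c z <-> E c z) -> G = E.
Proof.
move=> h; apply: functional_extensionality_dep => c.
by apply/funext => z; exact/propext.
Qed.

Lemma tmapC X Y c d (Psi : 'Hom(X, Y)) (g : 'Hom(S c, S d)) z :
  tmap Psi \1%VF (tmap \1%VF g z) = tmap \1%VF g (tmap Psi \1%VF z).
Proof. by rewrite !tmap_comp !(comp_lfun1l, comp_lfun1r). Qed.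

Lemma dual_system X (G : sfamily S X) : is_system G ->
  is_system (dual_family G).
Proof.
move=> [_ GS]; split=> [c|c d Phi z /dual_familyE hz].
  have -> : dual_family G c = [set z | forall y, G (star c) y -> 0 <=
      (bidual _ y \o spair S X c)%VF z].
    apply/seteqP; split=> z.
      by move=> /dual_familyE hz y Gy; rewrite comp_lfunE bidualE; apply: hz.
    move=> hz; apply/dual_familyE => y Gy; have := hz y Gy.
    by rewrite comp_lfunE bidualE.
  exact: closed_convex_cone_polar.
by apply/dual_familyE => y Gy; rewrite spair_nat; apply/hz/GS.
Qed.

(** The bipolar theorem at level star (star c), brought back to level c by the
    retraction, which the system respects. *)
Lemma systemP X (G : sfamily S X) c z : is_system G ->
  G c z <-> forall y, dual_family G (star c) y ->
    0 <= spair S X (star c) y (tmap \1%VF (stem_map S (double_dual_unit c)) z).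
Proof.
move=> [Gcl GS]; split=> [Gz y /dual_familyE|hz]; first by apply; apply: GS.
have [j jK] := double_dual_unit_retraction c.
rewrite -(tmap1 z) -stem_map_id -jK stem_map_comp -[\1%VF](comp_lfun1l \1%VF)
  -tmap_comp.
apply: GS; apply: (pairing_polar_r (spair_bij S X (star c))) (Gcl _) _ => y hy.
by apply: hz; apply/dual_familyE.
Qed.

Lemma dual_dual X (G : sfamily S X) : is_system G ->
  preim_family (bidual X) (dual_family (dual_family G)) = G.
Proof.
move=> hG; apply: family_ext => c z; rewrite (systemP _ hG).
split=> [/dual_familyE hz y Gy|hz]; first by rewrite -spair_bidual; apply: hz.
by apply/dual_familyE => y Gy; rewrite spair_bidual; apply: hz.
Qed.

Lemma dual_sub X (G E : sfamily S X) :
  sub_family G E -> sub_family (dual_family E) (dual_family G).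
Proof.
by move=> GE c z /dual_familyE hz; apply/dual_familyE => y /GE; apply: hz.
Qed.

Lemma dual_subP X (G E : sfamily S X) : is_system G -> is_system E ->
  sub_family G E <-> sub_family (dual_family E) (dual_family G).
Proof.
move=> hG hE; split=> [|EG c z]; first exact: dual_sub.
by rewrite (systemP _ hG) (systemP _ hE) => hz y /EG; apply: hz.
Qed.

Lemma dual_family_inj X (G E : sfamily S X) : is_system G -> is_system E ->
  dual_family G = dual_family E -> G = E.
Proof. by move=> hG hE e; rewrite -(dual_dual hG) e dual_dual. Qed.

Lemma dual_cap X (G E : sfamily S X) : is_system G -> is_system E ->
  dual_family (cap_family G E) = add_family (dual_family G) (dual_family E).
Proof.
move=> [Gcl GS] [Ecl ES]; apply: family_ext => c z.
split=> [/dual_familyE hz F [Fcl FGE]|hz].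
  apply: (pairing_polar_l (spair_bij S X c)) => // y Fy; apply: hz; split.
    apply: (pairing_polar_r (spair_bij S X c)) (Gcl _) _ => v hv.
    apply: Fy; apply: FGE.
    by left; apply/dual_familyE.
  apply: (pairing_polar_r (spair_bij S X c)) (Ecl _) _ => v hv.
  apply: Fy; apply: FGE.
  by right; apply/dual_familyE.
apply: hz; split.
  apply: (dual_system _).1; split=> [d|d e Phi y [Gy Ey]]; last first.
    by split; [exact: GS|exact: ES].
  rewrite (_ : cap_family G E d = \bigcap_(b : bool) (if b then G d else E d)).
    by apply: closed_convex_cone_bigcap => -[].
  apply/seteqP; split=> y; first by move=> [Gy Ey] [].
  by move=> h; split; [apply: (h true)|apply: (h false)].
by move=> v [] /dual_familyE hv; apply/dual_familyE => y [Gy Ey]; apply: hv.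
Qed.

Lemma dual_add X (G E : sfamily S X) :
  dual_family (add_family G E) = cap_family (dual_family G) (dual_family E).
Proof.
apply: family_ext => c z.
split=> [/dual_familyE hz|[/dual_familyE hG /dual_familyE hE]].
  split; apply/dual_familyE => y hy; apply: hz => F [_ FGE]; apply: FGE.
    by left.
  by right.
apply/dual_familyE => y /(_ [set v | 0 <= spair S X c z v]); apply.
split; last by move=> v [/hG|/hE].
by apply/closed_convex_coneP => x hx; apply: hx => v.
Qed.

Lemma dual_im X Y (Psi : 'Hom(X, Y)) (G : sfamily S X) :
  dual_family (im_family Psi G) = preim_family (dual_map Psi) (dual_family G).
Proof.
apply: family_ext => c z; split=> [/dual_familyE hz|/dual_familyE hz].
  apply/dual_familyE => y Gy; rewrite spair_dual_map; apply: hz.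
  by apply: vclosure_sub; exists y.
apply/dual_familyE => y.
rewrite -[_ -> _]/(im_family Psi G (star c) y -> _) => hy.
have : dual_cone (im_family Psi G (star c)) (spair S Y c z).
  rewrite dual_cone_vclosure => _ [x Gx <-]; rewrite -spair_dual_map; exact: hz.
exact.
Qed.

(** Both sides are closed, so it suffices to compare their polars in
    X (x) S (star c). *)
Lemma dual_preim X Y (Psi : 'Hom(X, Y)) (D : sfamily S Y) : is_system D ->
  dual_family (preim_family Psi D) = im_family (dual_map Psi) (dual_family D).
Proof.
move=> hD; have [Dcl DS] := hD; have [D'cl _] := dual_system hD.
apply: family_ext => c z; split=> [/dual_familyE hz|hz].
  apply: bipolar => [|phi hphi]; first exact/convex_cone_image/(D'cl c).1.
  have [y yE] := pairing_represents (spair_bij S X c) phi.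
  rewrite yE; apply: hz.
  apply: (pairing_polar_r (spair_bij S Y c)) (Dcl _) _ => v hv.
  rewrite -spair_dual_map -yE; apply: hphi; exists v => //.
  by apply/dual_familyE.
apply/dual_familyE => y Dy.
have : dual_cone (im_family (dual_map Psi) (dual_family D) c)
    (bidual _ y \o spair S X c)%VF.
  rewrite dual_cone_vclosure => _ [x /dual_familyE Dx <-].
  by rewrite comp_lfunE bidualE spair_dual_map; apply: Dx.
by move=> /(_ z hz); rewrite comp_lfunE bidualE.
Qed.

Lemma CP_dual X Y (E : sfamily S X) (D : sfamily S Y) (Psi : 'Hom(X, Y)) :
  is_system E -> is_system D ->
  CP E D Psi <-> CP (dual_family D) (dual_family E) (dual_map Psi).
Proof.
move=> hE hD; split=> [h c z /dual_familyE hz|h c z].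
  by apply/dual_familyE => y Ey; rewrite spair_dual_map; apply/hz/h.
move=> /(systemP _ hE) hz; apply/(systemP _ hD) => y Dy.
by rewrite -tmapC -spair_dual_map; apply/hz/h.
Qed.

Lemma dual_cone_coneB c (phi : dual (S c)) :
  dual_cone (coneB S c) phi <->
  forall Phi : chom cunit c, 0 <= phi (stem_map S Phi (seps S 1)).
Proof.
rewrite dual_cone_vclosure dual_cone_cone_hull.
by split=> [h Phi|h _ [Phi _ <-]] //; apply: h; exists Phi.
Qed.

Lemma mem_coneB c (Phi : chom cunit c) : coneB S c (stem_map S Phi (seps S 1)).
Proof. by apply: vclosure_sub => B [_]; apply; exists Phi. Qed.

Lemma closed_convex_cone_coneB c : closed_convex_cone (coneB S c).
Proof. exact/closed_convex_cone_vclosure/convex_cone_hull. Qed.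

(** Morphisms c -> star 1 and morphisms 1 -> star c correspond by star and the
    double dual unit of 1, and the two families of linear conditions agree. *)
Lemma coneAP c v :
  coneA S c v <-> forall b, coneB S (star c) b -> 0 <= sdelta S c b v.
Proof.
have e (phi : chom c (star cunit)) :
    sdelta S c (stem_map S (starh phi \c double_dual_unit cunit) (seps S 1)) v =
    sdelta S cunit (stem_map S phi v) (seps S 1).
  by rewrite stem_map_comp comp_lfunE sdelta_nat sdelta_double_dual_unit.
split=> [hv|hv phi]; last first.
  by rewrite -e; apply/hv/mem_coneB.
suff : dual_cone (coneB S (star c)) (bidual _ v \o sdelta S c)%VF.
  by move=> h b /h; rewrite comp_lfunE bidualE.
apply/dual_cone_coneB => Phi; rewrite comp_lfunE bidualE.
have [j jK] := double_dual_unit_retraction (cunit : C).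
have [k _ kK] := star_ff c (star cunit).
rewrite -[Phi]compc_idr -jK compcA -(kK (Phi \c j)) e; exact: hv.
Qed.

Lemma coneA_starP c s :
  coneA S (star c) s <-> forall b, coneB S c b -> 0 <= sdelta S c s b.
Proof.
have [k _ kK'] := star_ff cunit c.
have e (Phi : chom cunit c) :
    sdelta S cunit (stem_map S (starh Phi) s) (seps S 1) =
    sdelta S c s (stem_map S Phi (seps S 1)) by rewrite sdelta_nat.
split=> [hs|hs phi]; last first.
  by rewrite -(kK' phi) e; apply/hs/mem_coneB.
apply/dual_cone_coneB => Phi; rewrite -e; exact: hs.
Qed.

Lemma tdual_bidual X c z k b :
  tdual (dual (dual X)) (dual (S c)) (tmap (bidual (dual X)) (bidual (S c)) z)
    (bidual X k \ot sdelta S c b) = spair S X c z (k \ot b).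
Proof.
have [n [p [q [_ _ ->]]]] := tensor_sum z.
rewrite !linear_sum !sum_lfunE; apply: eq_bigr => i _ /=.
by rewrite tmap_tens tdual_tens !bidualE spair_tens tensE linearZ scale_lfunE.
Qed.

Lemma tdual_bidual_tr X c y (phi : dual X) b :
  tdual (dual X) (dual (S (star c))) (tmap (bidual X) (bidual (S (star c))) y)
    (phi \ot sdelta_tr S c b) = spair S X c (phi \ot b) y.
Proof.
have [n [p [q [_ _ ->]]]] := tensor_sum y.
rewrite !linear_sum !sum_lfunE; apply: eq_bigr => i _ /=.
by rewrite tmap_tens tdual_tens !bidualE spair_tens tensE linearZ scale_lfunE
  sdelta_trE.
Qed.

Lemma dual_min_family X (K : set X) : closed_convex_cone K ->
  dual_family (min_family S K) = max_family S (dual_cone K).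
Proof.
move=> /closed_convex_coneP hK; apply: family_ext => c z.
split=> [/dual_familyE hz|hz].
  apply/dual_cone_min_tensor => xi eta hxi heta.
  have [bd _ bdK] := bidual_bij X; have [k _ kK] := sdelta_bij S c.
  rewrite -(bdK xi) -(kK eta) tdual_bidual; apply: hz; apply: min_tensor_tens.
    by apply: hK => phi hphi; rewrite -bidualE bdK; apply: hxi.
  apply: (pairing_polar_l (sdelta_bij S c)).
    exact: closed_convex_cone_coneB.
  by move=> v /coneAP hv; rewrite kK; apply: heta.
apply/dual_familyE => y.
apply: (dual_cone_min_tensor _ _ (spair S X c z)).2 => k b Kk Bb.
rewrite -tdual_bidual; move/dual_cone_min_tensor: hz; apply.
  by move=> phi hphi; rewrite bidualE; apply: hphi.
by move=> v /coneAP; apply.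
Qed.

(** The largest family is by definition a polar, so its dual is a double polar;
    it is the smallest family because the latter is closed. *)
Lemma dual_max_family X (K : set X) : closed_convex_cone K ->
  dual_family (max_family S K) = min_family S (dual_cone K).
Proof.
move=> hK; have K'cl : closed_convex_cone (dual_cone K).
  have -> : dual_cone K = [set phi | forall x, K x -> 0 <= bidual X x phi].
    by apply/seteqP; split=> phi h x Kx; have := h x Kx; rewrite bidualE.
  exact: closed_convex_cone_polar.
have maxP c y : max_family S K (star c) y <->
    forall t, min_tensor (dual_cone K) (coneB S c) t -> 0 <= spair S X c t y.
  split=> [hy|hy].
    have : dual_cone (min_tensor (dual_cone K) (coneB S c))
        (bidual _ y \o spair S X c)%VF.
      apply/dual_cone_min_tensor => phi b hphi Bb.
      rewrite comp_lfunE bidualE -tdual_bidual_tr.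
      move/dual_cone_min_tensor: hy; apply=> // s /coneA_starP hs.
      by rewrite sdelta_trE; apply: hs.
    by move=> h t /h; rewrite comp_lfunE bidualE.
  apply/dual_cone_min_tensor => phi eta hphi heta.
  have [k _ kK] := sdelta_tr_bij S c.
  rewrite -(kK eta) tdual_bidual_tr; apply: hy; apply: min_tensor_tens => //.
  apply: (pairing_polar_l (sdelta_tr_bij S c)).
    exact: closed_convex_cone_coneB.
  move=> s hs; rewrite kK; apply: heta; apply/coneA_starP => b /hs.
  by rewrite sdelta_trE.
apply: family_ext => c z; split=> [/dual_familyE hz|hz].
  apply: (pairing_polar_l (spair_bij S X c)).
    apply: closed_convex_cone_min_tensor => //.
    exact: closed_convex_cone_coneB.
  by move=> y /maxP; apply: hz.
by apply/dual_familyE => y /maxP; apply.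
Qed.

End Systems.

(** * Hedra, hedrops and finitely generated systems *)

Section Hedra.
Context {R : realType} {C : starcat} (S : stem R C).
Implicit Types (X Y Z : vectType R) (c d : C).

(** The star autonomous bijection C(c (x) d, star 1)
    = C(c, star (d (x) star (star 1))) followed by star (star 1) = 1 and
    d (x) 1 = d. *)
Definition transpose c d (phi : chom (c \t* d) (star cunit)) :
    chom c (star d) :=
  starh ((idc d \h* double_dual_unit cunit) \c runitorV d) \c scurry phi.

Lemma transpose_surj c d (Phi : chom c (star d)) :
  exists phi, transpose phi = Phi.
Proof.
have [k _ kK] := scurry_bij c d (star (cunit : C)).
have [j jK] := double_dual_unit_retraction (cunit : C).
exists (k (starh (runitor d \c (idc d \h* j)) \c Phi)).
rewrite /transpose kK compcA -starh_comp compcA -[_ \c (idc d \h* _)]compcA.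
by rewrite -otimesh_comp jK compc_idl otimesh_id compc_idr runitorVK starh_id
  compc_idl.
Qed.

Lemma sdelta_transpose c d (phi : chom (c \t* d) (star cunit)) u v :
  sdelta S d (stem_map S (transpose phi) u) v =
  sdelta S cunit (stem_map S phi (smu S c d (u \ot v))) (seps S 1).
Proof.
rewrite /transpose stem_map_comp comp_lfunE sdelta_nat.
have rv : stem_map S (runitorV d) v = smu S d cunit (v \ot seps S 1).
  rewrite -[in LHS](smu_runit v) -comp_lfunE -stem_map_comp runitorK
    stem_map_id.
  by rewrite id_lfunE.
rewrite stem_map_comp comp_lfunE rv smu_nat stem_map_id id_lfunE stem_scurry.
exact: sdelta_double_dual_unit.
Qed.

Lemma smu_tmap c d c' d' (f : chom c c') (g : chom d d') z :
  smu S c' d' (tmap (stem_map S f) (stem_map S g) z) =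
  stem_map S (f \h* g) (smu S c d z).
Proof.
have [n [a [b [_ _ ->]]]] := tensor_sum z.
rewrite !linear_sum; apply: eq_bigr => i _ /=.
by rewrite tmap_tens smu_nat.
Qed.

Lemma intrinsic_system d : is_system (intrinsic S d).
Proof.
split=> [c|c c' Phi z hz phi].
  have -> : intrinsic S d c =
      [set z | forall phi : chom (d \t* c) (star cunit), True -> 0 <=
        (bidual _ (seps S 1) \o (sdelta S cunit \o
          (stem_map S phi \o smu S d c)))%VF z].
    apply/seteqP; split=> z hz phi.
      by move=> _; rewrite !comp_lfunE bidualE; apply: hz.
    by have := hz phi I; rewrite !comp_lfunE bidualE.
  exact: closed_convex_cone_polar.
rewrite -stem_map_id smu_tmap -(comp_lfunE (stem_map S phi)) -stem_map_comp.
exact: hz.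
Qed.

Lemma preim_system X Y (Psi : 'Hom(X, Y)) (D : sfamily S Y) :
  is_system D -> is_system (preim_family Psi D).
Proof.
move=> [Dcl DS]; split=> [c|c d Phi z Dz].
  exact: closed_convex_cone_preimage.
by rewrite /preim_family /= tmapC; apply: DS.
Qed.

Lemma preim_comp X Y Z (Psi : 'Hom(X, Y)) (Psi2 : 'Hom(Y, Z))
    (D : sfamily S Z) :
  preim_family Psi (preim_family Psi2 D) = preim_family (Psi2 \o Psi)%VF D.
Proof.
by apply: family_ext => c z; rewrite /preim_family /= tmap_comp comp_lfun1l.
Qed.

Lemma preim_id X (D : sfamily S X) : preim_family \1%VF D = D.
Proof. by apply: family_ext => c z; rewrite /preim_family /= tmap1. Qed.

Lemma hedron_system X (H : sfamily S X) : hedron H -> is_system H.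
Proof.
move=> [n [K [hK ->]]].
have Ks i : is_system (K i).
  by have [d [Psi ->]] := hK i; apply: preim_system; exact: intrinsic_system.
split=> [c|c d Phi z hz i _]; last by apply: (Ks i).2; apply: hz.
by apply: closed_convex_cone_bigcap => i; exact: (Ks i).1.
Qed.

Lemma hedron_preim X Y (Psi : 'Hom(X, Y)) (H : sfamily S Y) :
  hedron H -> hedron (preim_family Psi H).
Proof.
move=> [n [K [hK ->]]].
exists n, (fun i => preim_family Psi (K i)); split=> // i.
by have [d [Psi2 ->]] := hK i; exists d, (Psi2 \o Psi)%VF; rewrite preim_comp.
Qed.

(** Both sides are families of linear conditions on w, indexed by morphisms
    c (x) d -> star 1 on the left and c -> star d on the right; [transpose]
    matches them. *)
Lemma concreteP X c (a : X \ox S c) d (w : dual X \ox S d) :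
  preim_family (a : 'Hom(dual X, S c)) (intrinsic S c) d w <->
  forall Phi : chom c (star d),
    0 <= spair S X d w (tmap \1%VF (stem_map S Phi) a).
Proof.
have e (phi : chom (c \t* d) (star cunit)) :
    sdelta S cunit (stem_map S phi
      (smu S c d (tmap (a : 'Hom(dual X, S c)) \1%VF w))) (seps S 1) =
    spair S X d w (tmap \1%VF (stem_map S (transpose phi)) a).
  have [n [p [q [_ _ ->]]]] := tensor_sum w.
  rewrite !linear_sum !sum_lfunE; apply: eq_bigr => i _ /=.
  by rewrite tmap_tens spair_tens tmapE comp_lfun1r id_lfunE sdelta_transpose.
split=> [h Phi|h phi]; last by rewrite e.
by have [phi <-] := transpose_surj Phi; rewrite -e; apply: h.
Qed.

Section Generators.
Variables (X : vectType R) (n : nat) (c : 'I_n -> C).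
Variable a : forall i, X \ox S (c i).

(** An element of X (x) S (c i) is by definition a linear map X' -> S (c i). *)
Definition generator_hedron : sfamily S (dual X) := fun d =>
  \bigcap_i preim_family (a i : 'Hom(dual X, S (c i))) (intrinsic S (c i)) d.

Lemma generator_hedron_hedron : hedron generator_hedron.
Proof.
exists n, (fun i =>
  preim_family (a i : 'Hom(dual X, S (c i))) (intrinsic S (c i))).
by split=> // i; exists (c i), (a i).
Qed.

Lemma dual_sub_generator_hedron (E : sfamily S X) : is_system E ->
  (forall i, E (c i) (a i)) -> sub_family (dual_family E) generator_hedron.
Proof.
move=> hE Ea d w /dual_familyE hw i _; apply/concreteP => Phi; apply: hw.
exact: hE.2.
Qed.

(** The system E below contains the generators, hence G, so the dual of G
    contains the hedron. *)
Lemma dual_generated (G : sfamily S X) :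
  is_system G -> (forall i, G (c i) (a i)) ->
  (forall E : sfamily S X, is_system E -> (forall i, E (c i) (a i)) ->
    sub_family G E) ->
  dual_family G = generator_hedron.
Proof.
move=> hG Ga Gmin; apply: family_ext => d w.
split; first exact: dual_sub_generator_hedron.
move=> hw; apply/dual_familyE.
(* E is the largest system whose dual contains the hedron. *)
pose E : sfamily S X := fun c' => [set z | forall t : {d : C &
    (dual X \ox S d) * chom c' (star d)}%type,
  generator_hedron (projT2 t).1 ->
  0 <= spair S X _ (projT2 t).1 (tmap \1%VF (stem_map S (projT2 t).2) z)].
have hE : is_system E.
  split=> [c'|c' c'' Phi z hz [d' [w' Phi']] /= hw'].
    have -> : E c' = [set z | forall t : {d : C &
        (dual X \ox S d) * chom c' (star d)}%type,
      generator_hedron (projT2 t).1 -> 0 <=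
      (spair S X _ (projT2 t).1 \o tmap \1 (stem_map S (projT2 t).2))%VF z].
      by apply/seteqP; split=> z hz t ht; have := hz t ht; rewrite comp_lfunE.
    exact: closed_convex_cone_polar.
  rewrite tmap_comp comp_lfun1l -stem_map_comp.
  by apply: (hz (existT _ d' (w', Phi' \c Phi))).
have Ea i : E (c i) (a i).
  by move=> [d' [w' Phi]] /= hw'; have /concreteP := hw' i I; apply.
move=> y /(Gmin E hE Ea) /(_ (existT _ d (w, idc _)) hw) /=.
by rewrite stem_map_id tmap1.
Qed.

Lemma generated_of_dual (G : sfamily S X) : is_system G ->
  dual_family G = generator_hedron -> finitely_generated G.
Proof.
move=> hG e; split=> //; exists n, c, a; split=> [i|E hE Ea].
  apply/(systemP _ hG) => y; rewrite e => /(_ i I) /concreteP; apply.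
by apply/dual_subP => //; rewrite e; exact: dual_sub_generator_hedron.
Qed.

End Generators.

Lemma hedron_generators X (H : sfamily S (dual X)) : hedron H ->
  exists n (c : 'I_n -> C) (a : forall i, X \ox S (c i)),
    H = generator_hedron a.
Proof.
move=> [n [K [hK ->]]].
pose c i := projT1 (cid (hK i)).
pose a i : X \ox S (c i) := projT1 (cid (projT2 (cid (hK i)))).
exists n, c, a; apply: family_ext => d z; rewrite /generator_hedron.
have e i : K i = preim_family (a i : 'Hom(dual X, S (c i))) (intrinsic S (c i)).
  exact: projT2 (cid (projT2 (cid (hK i)))).
by split=> hz i _; have := hz i I; rewrite e.
Qed.

(** Any finite list of concrete realizations on X' is a finite list of elements
    of the spaces X (x) S (c i): generators of the predual. *)
Lemma generated_dual_hedron X (G : sfamily S X) : is_system G ->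
  finitely_generated G <-> hedron (dual_family G).
Proof.
move=> hG; split=> [[_ [n [c [a [Ga Gmin]]]]]|/hedron_generators[n [c [a e]]]].
  by rewrite (dual_generated hG Ga Gmin); exact: generator_hedron_hedron.
exact: generated_of_dual e.
Qed.

Lemma preim_bidual_inv X (H : sfamily S X) (H2 : sfamily S (dual (dual X))) :
  preim_family (bidual X) H2 = H -> preim_family ((bidual X)^-1)%VF H = H2.
Proof.
move=> <-; rewrite preim_comp.
have k0 : lker (bidual X) == 0%VS by apply/lker0P/bij_inj/bidual_bij.
suff -> : (bidual X \o (bidual X)^-1)%VF = \1%VF by exact: preim_id.
have [k _ kK] := bidual_bij X; apply/lfunP => x.
by rewrite comp_lfunE id_lfunE -(kK x) lker0_lfunK.
Qed.

Lemma hedron_dual_generated X (G : sfamily S X) : is_system G ->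
  hedron G <-> finitely_generated (dual_family G).
Proof.
move=> hG; rewrite (generated_dual_hedron (dual_system hG)); split=> h.
  rewrite -(preim_bidual_inv (dual_dual hG)); exact: hedron_preim.
rewrite -(dual_dual hG); exact: hedron_preim.
Qed.

Lemma im_system X Y (Psi : 'Hom(X, Y)) (G : sfamily S X) :
  is_system G -> is_system (im_family Psi G).
Proof.
move=> [Gcl GS]; have imcone c := convex_cone_image (tmap Psi \1%VF) (Gcl c).1.
split=> [c|c d Phi z hz]; first exact: closed_convex_cone_vclosure.
apply: bipolar => // theta htheta; rewrite -comp_lfunE.
have : dual_cone (im_family Psi G c) (theta \o tmap \1 (stem_map S Phi))%VF.
  rewrite dual_cone_vclosure => _ [x Gx <-]; rewrite comp_lfunE -tmapC.
  by apply: htheta; exists (tmap \1%VF (stem_map S Phi) x) => //; apply: GS.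
exact.
Qed.

Lemma preim_generated_dual_hedrop X (G : sfamily S X) : is_system G ->
  preim_finitely_generated G <-> hedrop (dual_family G).
Proof.
move=> hG; split=> [[Z [H [Psi [hH ->]]]]|[Z [H [Psi [hH e]]]]].
  exists (dual Z), (dual_family H), (dual_map Psi).
  have Hs : is_system H by case: hH.
  split; first exact/generated_dual_hedron.
  exact: dual_preim.
have Hs := hedron_system hH.
exists (dual Z), (dual_family H), (dual_map Psi \o bidual X)%VF.
split; first exact/hedron_dual_generated.
by rewrite -preim_comp -dual_im -e dual_dual.
Qed.

(** For the converse, G is compared with the image of the dual of H under the
    transpose of Psi: their duals agree by biduality of H, so they are equal. *)
Lemma hedrop_dual_preim_generated X (G : sfamily S X) : is_system G ->
  hedrop G <-> preim_finitely_generated (dual_family G).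
Proof.
move=> hG; split=> [[Z [H [Psi [hH ->]]]]|[Z [H [Psi [hH e]]]]].
  exists (dual Z), (dual_family H), (dual_map Psi); rewrite dual_im.
  by split=> //; apply/hedron_dual_generated => //; exact: hedron_system.
have Hs : is_system H by case: hH.
have bK : cancel (bidual X) ((bidual X)^-1)%VF.
  by apply: lker0_lfunK; apply/lker0P/bij_inj/bidual_bij.
have [k _ kK] := bidual_bij X.
exists (dual Z), (dual_family H), ((bidual X)^-1 \o dual_map Psi)%VF.
split; first exact/generated_dual_hedron.
have Is := im_system ((bidual X)^-1 \o dual_map Psi)%VF (dual_system Hs).
apply: (dual_family_inj hG Is).
rewrite dual_im e -{1}(dual_dual Hs) preim_comp.
suff -> : dual_map ((bidual X)^-1 \o dual_map Psi)%VF =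
    (bidual Z \o Psi)%VF by [].
apply/lfunP => phi; apply/lfunP => zeta.
rewrite dual_mapE !comp_lfunE bidualE -(kK (dual_map Psi zeta)) bK.
by rewrite -bidualE kK dual_mapE.
Qed.

End Hedra.

Theorem theorem3p17 (R : realType) (C : starcat) (S : stem R C)
    (X Y : vectType R) (G E : sfamily S X) (D : sfamily S Y)
    (Psi : 'Hom(X, Y)) (K : set X)
    (hG : is_system G) (hE : is_system E) (hD : is_system D)
    (hK : closed_convex_cone K) :
  (* i *)
  is_system (dual_family G) /\
  (* ii *)
  preim_family (bidual X) (dual_family (dual_family G)) = G /\
  (* iii *)
  (sub_family G E <-> sub_family (dual_family E) (dual_family G)) /\
  (* iv *)
  (dual_family (min_family S K) = max_family S (dual_cone K) /\
   dual_family (max_family S K) = min_family S (dual_cone K)) /\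
  (* v *)
  (dual_family (add_family G E) =
     cap_family (dual_family G) (dual_family E) /\
   dual_family (cap_family G E) =
     add_family (dual_family G) (dual_family E)) /\
  (* vi *)
  (dual_family (im_family Psi G) =
     preim_family (dual_map Psi) (dual_family G) /\
   dual_family (preim_family Psi D) =
     im_family (dual_map Psi) (dual_family D)) /\
  (* vii *)
  (CP E D Psi <-> CP (dual_family D) (dual_family E) (dual_map Psi)) /\
  (* viii *)
  ((finitely_generated G <-> hedron (dual_family G)) /\
   (hedron G <-> finitely_generated (dual_family G))) /\
  (* ix *)
  ((preim_finitely_generated G <-> hedrop (dual_family G)) /\
   (hedrop G <-> preim_finitely_generated (dual_family G))).
Proof.
split; first exact: dual_system.
split; first exact: dual_dual.
split; first exact: dual_subP.
split; first by split; [exact: dual_min_family|exact: dual_max_family].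
split; first by split; [exact: dual_add|exact: dual_cap].
split; first by split; [exact: dual_im|exact: dual_preim].
split; first exact: CP_dual.
split; first split.
- exact: generated_dual_hedron.
- exact: hedron_dual_generated.
split.
- exact: preim_generated_dual_hedrop.
- exact: hedrop_dual_preim_generated.
Qed.
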